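(* Let $L\ge 1$ be an integer, let $0\le q<1$, $0<\alpha,\beta\leq 1$, and suppose that Liggett's condition $\gamma=q(1-\alpha)$, $\delta=q(1-\beta)$ holds. Put $\mathsf a=\frac{1-\alpha}{\alpha}\ge 0$ and $\mathsf b=\frac{1-\beta}{\beta}\ge 0$. Then the invariant measure $\mu$ on $\Omega_L=\{0,1\}^L$ of the open ASEP on $\{1,\dots,L\}$ with parameters $q,\alpha,\beta,\gamma,\delta$ is the marginal of the top layer of the two-layer ensemble $P_{\rm TL}$ with parameters $\mathsf a,\mathsf b,q$: $$\mu(\boldsymbol\tau)=\sum_{\boldsymbol\xi\in\Omega_L}P_{\rm TL}\begin{pmatrix}\boldsymbol\tau\\ \boldsymbol\xi\end{pmatrix},\qquad \boldsymbol\tau\in\Omega_L .$$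
   Context: **Open ASEP.** Fix $L\ge1$. The open asymmetric simple exclusion process on sites $\{1,\dots,L\}$ with parameters $0\le q<1$, $\alpha,\beta>0$, $\gamma,\delta\ge 0$ is the continuous-time Markov process on $\Omega_L=\{0,1\}^L$ ($\tau_j=1$ means that site $j$ is occupied, $\tau_j=0$ that it is vacant) with the following transitions. For $1\le j\le L-1$, a particle at $j$ jumps to $j+1$ at rate $1$ if $j+1$ is vacant, and a particle at $j+1$ jumps to $j$ at rate $q$ if $j$ is vacant. At site $1$, a particle is created at rate $\alpha$ if the site is vacant and removed at rate $\gamma$ if it is occupied. At site $L$, a particle is removed at rate $\beta$ if the site is occupied and created at rate $\delta$ if it is vacant. This process has a unique invariant (stationary) probability measure $\mu$ on $\Omega_L$. **$q$-notation.** $(z;q)_n=\prod_{k=0}^{n-1}(1-zq^k)$ and $[n]_q=1+q+\dots+q^{n-1}$ (with $q^0=1$ also when $q=0$, and $0^0=1$ throughout). The Jackson derivative is $(\mathcal D_q f)(z)=\frac{f(z)-f(qz)}{z(1-q)}$ for $z\neq0$. It is applied here to rational functions that are regular at $0$; the result is again such a function, and for $q=0$ the term $f(qz)$ is the value $f(0)$ of the rational function at $0$. $\mathcal D_q z$ denotes the operator $f\mapsto \mathcal D_q[zf(z)]$. **Compositions and polynomials $w_{\boldsymbol\sigma}$.** A composition $\boldsymbol\sigma=(\sigma_0,\dots,\sigma_r)$ of $L+1$ into $r+1$ parts is a sequence of strictly positive integers with $\sigma_0+\dots+\sigma_r=L+1$. For such $\boldsymbol\sigma$ and $z\ne 0,1,1/q,1/q^2,\dots$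 define $$w_{\boldsymbol\sigma}(z)=(z;q)_{L+2}\prod_{j=0}^r\Big((\mathcal D_q z)^{\sigma_j-1}\mathcal D_q\Big)\Big[\tfrac1{1-z}\Big],$$ where the factors in the operator product are ordered from $j=0$ on the left to $j=r$ on the right. This expression is a polynomial in $z$ with nonnegative coefficients, so $w_{\boldsymbol\sigma}(z)$ is defined for all real $z$ by this polynomial; for $|z|<1$ it equals $(z;q)_{L+2}\sum_{n=0}^\infty z^n\prod_{j=0}^r([n+j+1]_q)^{\sigma_j}$. **Paths.** For $(\boldsymbol\tau,\boldsymbol\xi)\in\Omega_L\times\Omega_L$ (top layer $\boldsymbol\tau$, bottom layer $\boldsymbol\xi$) let $\boldsymbol\gamma=\gamma(\boldsymbol\tau,\boldsymbol\xi)=(\gamma_0,\dots,\gamma_L)$ with $\gamma_0=0$ and $\gamma_k=\sum_{j=1}^k(\tau_j-\xi_j)$ (not to be confused with the scalar rate $\gamma$). Let $\min(\boldsymbol\gamma)$ and $\max(\boldsymbol\gamma)$ be the minimum and the maximum of $\gamma_0,\dots,\gamma_L$, let $r=\max(\boldsymbol\gamma)-\min(\boldsymbol\gamma)$, and let $\sigma(\boldsymbol\gamma)=(\sigma_0,\dots,\sigma_r)$ be the composition of $L+1$ given by $\sigma_i=\#\{j\in\{0,\dots,L\}:\gamma_j=\min(\boldsymbol\gamma)+i\}$. **Two-layer ensemble.** For $\mathsf a,\mathsf b\ge0$ put $$Q\begin{pmatrix}\boldsymbol\tau\\ \boldsymbol\xi\end{pmatrix}=\frac{\mathsf b^{\gamma_L}}{(\mathsf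 a\mathsf b)^{\min(\boldsymbol\gamma)}}\,w_{\sigma(\boldsymbol\gamma)}(\mathsf a\mathsf b),$$ where the prefactor is understood as the monomial $\mathsf a^{-\min(\boldsymbol\gamma)}\mathsf b^{\gamma_L-\min(\boldsymbol\gamma)}$, whose exponents are nonnegative (as $\min(\boldsymbol\gamma)\le 0$). The two-layer ensemble is the probability measure on $\Omega_L\times\Omega_L$ $$P_{\rm TL}\begin{pmatrix}\boldsymbol\tau\\ \boldsymbol\xi\end{pmatrix}=\frac1Z\,Q\begin{pmatrix}\boldsymbol\tau\\ \boldsymbol\xi\end{pmatrix},\qquad Z=\sum_{\boldsymbol\tau,\boldsymbol\xi\in\Omega_L}Q\begin{pmatrix}\boldsymbol\tau\\ \boldsymbol\xi\end{pmatrix}>0.$$ *)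

(* Defs.v *)
From HB Require Import structures.
From mathcomp Require Import all_boot all_order all_algebra.
From mathcomp Require Import generic_quotient perm.
From mathcomp Require Import all_classical all_reals all_analysis.
From mathcomp Require Import ring lra.

Set Implicit Arguments.
Unset Strict Implicit.
Unset Printing Implicit Defensive.

Import Order.TTheory GRing.Theory Num.Theory.
Import numFieldNormedType.Exports.

Local Open Scope ring_scope.

(* Site j of {1, ..., L} is the ordinal of value j - 1; [true] = occupied. *)
Definition config (L : nat) := {ffun 'I_L -> bool}.

Section OpenASEP.
Variables (R : realType) (L : nat).
Implicit Types (x : config L) (f mu : config L -> R).

Definition flip (j : 'I_L) x : config L :=
  [ffun i => if i == j then ~~ x i else x i].

Definition swap (j k : 'I_L) x : config L := [ffun i => x (tperm j k i)].

(* For L = 1 the two boundary reservoirs act on the same site, and their rates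
   add up. *)
Definition asep_generator (q alpha beta gamma delta : R) f x : R :=
    \sum_(j < L) \sum_(k < L | k == j.+1 :> nat)
      (if x j && ~~ x k then 1 else if ~~ x j && x k then q else 0)
        * (f (swap j k x) - f x)
  + \sum_(j < L | j == 0%N :> nat)
      (if x j then gamma else alpha) * (f (flip j x) - f x)
  + \sum_(j < L | j.+1 == L)
      (if x j then beta else delta) * (f (flip j x) - f x).

(* exp (t G) for the operator G, as an everywhere convergent power series
   in t. *)
Definition semigroup (G : (config L -> R) -> config L -> R) (t : R) f x : R :=
  limn (series (fun n => t ^+ n / n`!%:R * iter n G f x)).

Definition invariant_probability
    (G : (config L -> R) -> config L -> R) (mu : config L -> R) : Prop :=
  [/\ forall x, 0 <= mu x,
      \sum_x mu x = 1 &
      forall (t : R) f, 0 <= t ->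
        \sum_x mu x * semigroup G t f x = \sum_x mu x * f x].

(* The series defining [semigroup] does converge. *)
Lemma is_cvg_semigroup (q alpha beta gamma delta t : R) f x :
  cvgn (series (fun n =>
    t ^+ n / n`!%:R * iter n (asep_generator q alpha beta gamma delta) f x)).
Proof.
set G := asep_generator _ _ _ _ _.
pose N (g : config L -> R) : R := \sum_y `|g y|.
have N_ge g y : `|g y| <= N g.
  by rewrite /N (bigD1 y) //= lerDl; apply: sumr_ge0.
have N0 g : 0 <= N g by apply: sumr_ge0.
pose r : R := 1 + `|q| + `|alpha| + `|beta| + `|gamma| + `|delta|.
have r1 : 1 <= r by rewrite /r -!addrA lerDl !addr_ge0.
have bnd (c : R) g y z : `|c| <= r -> `|c * (g y - g z)| <= r * (N g *+ 2).
  move=> cr; rewrite normrM; apply: ler_pM => //.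
  by apply: le_trans (ler_normB _ _) _; rewrite mulr2n lerD.
have hq : `|q| <= r /\ `|alpha| <= r /\ `|beta| <= r /\ `|gamma| <= r /\
    `|delta| <= r.
  have := (normr_ge0 q, normr_ge0 alpha, normr_ge0 beta, normr_ge0 gamma,
    normr_ge0 delta).
  rewrite /r => -[[[[]]]] *; do 4?split; lra.
have {hq} [rq [ra [rb [rg rd]]]] := hq.
have rn1 : `|1 : R| <= r by rewrite normr1.
have rn0 : `|0 : R| <= r by rewrite normr0 (le_trans ler01).
have sum_le P (F : 'I_L -> R) (B : R) : 0 <= B -> (forall j, `|F j| <= B) ->
    `|\sum_(j < L | P j) F j| <= B *+ L.
  move=> B0 FB; apply: le_trans (ler_norm_sum _ _ _) _.
  rewrite -[X in B *+ X]card_ord -sumr_const big_mkcond /=.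
  by apply: ler_sum => j _; case: ifP.
have [C [C0 HC]] : exists C : R, 0 <= C /\ forall g y, `|G g y| <= C * N g.
  exists (r *+ 2 *+ L *+ L + r *+ 2 *+ L + r *+ 2 *+ L).
  have r0 := le_trans ler01 r1.
  split; first by rewrite !addr_ge0 // !mulrn_wge0.
  move=> g y.
  have rN0 : 0 <= r * (N g *+ 2) by rewrite mulr_ge0 // mulrn_wge0.
  move: rN0; set B := r * _ => rN0.
  have -> : (r *+ 2 *+ L *+ L + r *+ 2 *+ L + r *+ 2 *+ L) * N g
      = B *+ L *+ L + B *+ L + B *+ L by rewrite /B; ring.
  apply: le_trans (ler_normD _ _) _; apply: lerD.
    apply: le_trans (ler_normD _ _) _; apply: lerD.
      apply: (sum_le) => [|j]; first by rewrite mulrn_wge0.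
      by apply: (sum_le) => // k; apply: bnd; do ![case: ifP => //].
    by apply: (sum_le) => // j; apply: bnd; case: ifP.
  by apply: (sum_le) => // j; apply: bnd; case: ifP.
pose D : R := C * #|config L|%:R.
have D0 : 0 <= D by rewrite mulr_ge0.
have HN n : N (iter n G f) <= D ^+ n * N f.
  elim: n => [|n IH]; first by rewrite expr0 mul1r.
  rewrite iterS exprS -mulrA.
  apply: le_trans (ler_wpM2l D0 IH).
  rewrite /D mulrAC mulr_natr -sumr_const.
  by apply: ler_sum => y _; apply: HC.
apply: normed_cvg.
apply: (@series_le_cvg _ _ (fun n => exp_coeff (`|t| * D) n * N f)).
- by move=> n; exact: normr_ge0.
- by move=> n; rewrite mulr_ge0 // exp_coeff_ge0 // mulr_ge0.
- move=> n; rewrite /exp_coeff /= !normrM normrX normfV normr_nat exprMn.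
  rewrite [X in _ <= X * _]mulrAC -[leRHS]mulrA.
  apply: ler_wpM2l; first by rewrite divr_ge0 // exprn_ge0.
  exact: le_trans (N_ge _ _) (HN n).
have -> : series (fun n => exp_coeff (`|t| * D) n * N f)
        = (fun n => N f *: series (exp_coeff (`|t| * D)) n).
  apply/funext => n; rewrite /series /= scaler_sumr.
  by apply: eq_bigr => i _; rewrite mulrC.
by apply: is_cvgZl_tmp; exact: is_cvg_series_exp_coeff.
Qed.

End OpenASEP.

Section QDerivative.
Variable R : realType.
Local Notation "p %:F" := (@tofrac {poly R} p).
Implicit Types (f : {fraction {poly R}}) (n d p : {poly R}) (q : R).

Definition frac_num f : {poly R} := (frac (repr f)).1.
Definition frac_den f : {poly R} := (frac (repr f)).2.

Definition reduced_num f : {poly R} :=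
  frac_num f %/ gcdp (frac_num f) (frac_den f).
Definition reduced_den f : {poly R} :=
  frac_den f %/ gcdp (frac_num f) (frac_den f).

(* The rational function f(q z).  Working with the reduced fraction makes this
   meaningful at q = 0 too, where it is the constant f(0) as soon as f is
   regular at 0; see [dilateE]. *)
Definition dilate q f : {fraction {poly R}} :=
  (reduced_num f \Po (q *: 'X))%:F / (reduced_den f \Po (q *: 'X))%:F.

Definition jackson q f : {fraction {poly R}} :=
  (f - dilate q f) / ('X * (1 - q)%:P)%:F.

Definition jacksonX q f : {fraction {poly R}} := jackson q ('X%:F * f).

Definition qpoch q (n : nat) : {poly R} := \prod_(k < n) (1 - q ^+ k *: 'X).

(* [foldr] applies the factor of the head of sigma last, i.e. on the left. *)
Definition w_frac (L : nat) q (sigma : seq nat) : {fraction {poly R}} :=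
  (qpoch q L.+2)%:F *
  foldr (fun s f => iter s.-1 (jacksonX q) (jackson q f))
        (1 / (1 - 'X)%:F) sigma.

(* When sigma is a composition of L + 1, [w_frac L q sigma] is a polynomial
   (lemma [w_polyE]), and this is that polynomial. *)
Definition w_poly (L : nat) q (sigma : seq nat) : {poly R} :=
  frac_num (w_frac L q sigma) %/ frac_den (w_frac L q sigma).

Lemma frac_den_neq0 f : frac_den f != 0.
Proof. exact: denom_ratioP. Qed.

Lemma fracE f : f = (frac_num f)%:F / (frac_den f)%:F.
Proof.
have d0 := frac_den_neq0 f.
apply: (canRL (mulfK _)); first by rewrite tofrac_eq0.
rewrite -[LHS]/(FracField.mul _ _) -[X in FracField.mul X _]reprK !piE.
apply/eqP; rewrite FracField.equivf_def /FracField.mulf.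
by rewrite !numden_Ratio ?mulf_neq0 ?oner_neq0 // ?mulr1 mulrC.
Qed.

Lemma frac_num_den f n d : d != 0 -> f = n%:F / d%:F ->
  frac_num f * d = n * frac_den f.
Proof.
move=> d0 fE.
have dF : d%:F != 0 by rewrite tofrac_eq0.
have eF : (frac_den f)%:F != 0 by rewrite tofrac_eq0 frac_den_neq0.
have e : n%:F / d%:F = (frac_num f)%:F / (frac_den f)%:F.
  by rewrite -fE; exact: fracE.
move/eqP: e; rewrite (eqr_div _ _ dF eF) -!tofracM tofrac_eq => /eqP e.
exact: esym.
Qed.

Lemma dilateE q n d : d.[0] != 0 ->
  dilate q (n%:F / d%:F) = (n \Po (q *: 'X))%:F / (d \Po (q *: 'X))%:F.
Proof.
move=> dz; have d0 : d != 0 by apply: contraNneq dz => ->; rewrite horner0.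
set f := n%:F / d%:F; have := frac_num_den d0 (erefl f).
rewrite /dilate /reduced_num /reduced_den.
move: (frac_den_neq0 f); set a := frac_num f; set b := frac_den f.
move=> b0 abE; set g := gcdp a b.
have g0 : g != 0 by rewrite gcdp_eq0 negb_and b0 orbT.
have aE : a = a %/ g * g by rewrite divpK // dvdp_gcdl.
have bE : b = b %/ g * g by rewrite divpK // dvdp_gcdr.
have cop : coprimep (b %/ g) (a %/ g).
  by rewrite coprimep_sym; apply: coprimep_div_gcd; rewrite b0 orbT.
move: aE bE cop; set a' := a %/ g; set b' := b %/ g => aE bE cop.
have ab' : a' * d = n * b'.
  by apply: (mulIf g0); rewrite mulrAC -aE abE bE mulrA.
have /dvdpP[c dE] : b' %| d.
  by rewrite -(Gauss_dvdpr _ cop) ab' dvdp_mull.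
have nonz p : p.[0] != 0 -> p \Po (q *: 'X) != 0.
  apply: contraNneq => /(congr1 (horner^~ 0)).
by rewrite horner_comp !hornerE => ->.
have b'z : b'.[0] != 0.
  by apply: contraNneq dz => e; rewrite dE hornerM e mulr0.
apply/eqP; rewrite eqr_div ?tofrac_eq0 ?nonz //.
by rewrite -!tofracM tofrac_eq -!comp_polyM ab'.
Qed.

Lemma qpoch0 q k : (qpoch q k).[0] = 1.
Proof.
rewrite horner_prod big1 // => i _.
by rewrite !hornerE ?subr0.
Qed.

Fact frac_step (F : fieldType) (n n' p p' b c P u X m : F) :
  n * b - n' * c = u -> p * b = P -> c * p' = P -> P != 0 -> X != 0 ->
  X * m = u -> (n / p - n' / p') / X = m / P.
Proof.
move=> <- bP cP P0 X0 Xm.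
have : p * b * (c * p') != 0 by rewrite bP cP mulf_neq0.
rewrite !mulf_eq0 !negb_or => /andP[/andP[p0 b0] /andP[c0 p'0]].
have -> : n / p = n * b / P by rewrite -bP -mulf_div divff ?mulr1.
have -> : n' / p' = n' * c / P.
  by rewrite -cP [c * p']mulrC -mulf_div divff ?mulr1.
rewrite -mulrBl -Xm; have -> : X * m / P / X = (X / X) * (m / P) by ring.
by rewrite divff ?mul1r.
Qed.

Lemma jackson_qpoch q n k : q < 1 -> exists m,
  jackson q (n%:F / (qpoch q k.+1)%:F) = m%:F / (qpoch q k.+2)%:F.
Proof.
move=> q1.
have dil : (1 - 'X) * (qpoch q k.+1 \Po (q *: 'X)) = qpoch q k.+2.
  rewrite /qpoch [RHS]big_ord_recl expr0 scale1r rmorph_prod; congr (_ * _).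
  apply: eq_bigr => i _; rewrite rmorphB rmorph1 /= comp_polyZ comp_polyX.
  by rewrite scalerA -exprSr.
have last : qpoch q k.+2 = qpoch q k.+1 * (1 - q ^+ k.+1 *: 'X).
  by rewrite /qpoch big_ord_recr.
pose u := n * (1 - q ^+ k.+1 *: 'X) - (n \Po (q *: 'X)) * (1 - 'X).
have /dvdpP[v uE] : 'X %| u.
  rewrite -[X in X %| _]subr0 -[X in 'X - X]polyC0 dvdp_XsubCl.
  apply/eqP; rewrite /u !hornerE horner_comp !hornerE.
  by rewrite ?mulr0 ?subr0 ?mulr1 subrr.
exists ((1 - q)^-1 *: v).
have q0 : 1 - q != 0 by rewrite subr_eq0 gt_eqF.
have pnz j : qpoch q j != 0.
  apply/eqP => /(congr1 (horner^~ 0)); rewrite qpoch0 horner0.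
  exact/eqP/oner_neq0.
have pd : qpoch q k.+1 \Po (q *: 'X) != 0.
  by apply: contraNneq (pnz k.+2) => e; rewrite -dil e mulr0.
have X0 : 'X * (1 - q)%:P != 0 :> {poly R}.
  by rewrite mulf_neq0 ?polyX_eq0 ?polyC_eq0.
have uF : u%:F = n%:F * (1 - q ^+ k.+1 *: 'X)%:F
                  - (n \Po (q *: 'X))%:F * (1 - 'X)%:F.
  by rewrite /u tofracB !tofracM.
rewrite /jackson dilateE ?qpoch0 ?oner_neq0 //.
apply: (frac_step (esym uF)).
- by rewrite -tofracM -last.
- by rewrite -tofracM dil.
- by rewrite tofrac_eq0.
- by rewrite tofrac_eq0.
- rewrite uE -!tofracM; congr (_%:F).
  rewrite -mul_polyC.
  have e : (1 - q)^-1%:P * (1 - q)%:P = 1 :> {poly R}.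
    by rewrite -polyCM mulVf.
  by rewrite -mulrA mulrC [_%:P * (_ * _)]mulrA [_%:P * _%:P]mulrC e mul1r.
Qed.

Lemma w_polyE (L : nat) q (sigma : seq nat) : q < 1 ->
  all (leq 1) sigma -> sumn sigma = L.+1 ->
  (w_poly L q sigma)%:F = w_frac L q sigma.
Proof.
move=> q1 s1 sL.
have [m mE] : exists m,
    foldr (fun s f => iter s.-1 (jacksonX q) (jackson q f))
      (1 / (1 - 'X)%:F) sigma = m%:F / (qpoch q (sumn sigma).+1)%:F.
  elim: sigma s1 {sL} => [_|s sigma IH /= /andP[s0 /IH[m ->]]].
    exists 1; rewrite /= tofrac1 /qpoch big_ord_recl big_ord0 mulr1.
    by rewrite expr0 scale1r.
  case: s s0 => // s _ /=.
  elim: s => [|s [m' IHs]]; first exact: jackson_qpoch.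
  by rewrite iterS IHs /jacksonX mulrA -tofracM; exact: jackson_qpoch.
have p0 : qpoch q L.+2 != 0.
  apply/eqP => /(congr1 (horner^~ 0)); rewrite qpoch0 horner0.
  exact/eqP/oner_neq0.
have wE : w_frac L q sigma = m%:F / 1%:F.
  rewrite /w_frac mE sL tofrac1 divr1.
  by rewrite mulrCA divff ?mulr1 // tofrac_eq0.
have := frac_num_den (oner_neq0 _) wE; rewrite mulr1 /w_poly => ->.
by rewrite mulpK ?frac_den_neq0 // wE tofrac1 divr1.
Qed.

End QDerivative.

Section TwoLayer.
Variables (R : realType) (L : nat).
Implicit Types tau xi : config L.

Definition path_height tau xi (k : nat) : int :=
  \sum_(j < L | (j < k)%N) ((tau j)%:Z - (xi j)%:Z).

(* The initial value 0 of the two iterated operations is the height of the path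
   at k = 0. *)
Definition path_min tau xi : int :=
  \big[Num.min/0]_(k < L.+1) path_height tau xi k.
Definition path_max tau xi : int :=
  \big[Num.max/0]_(k < L.+1) path_height tau xi k.

Definition path_composition tau xi : seq nat :=
  mkseq (fun i => #|[set k : 'I_L.+1 |
                      path_height tau xi k == path_min tau xi + i%:Z]|)
        `|path_max tau xi - path_min tau xi|%N.+1.

Definition TL_weight (a b q : R) tau xi : R :=
  a ^ (- path_min tau xi) * b ^ (path_height tau xi L - path_min tau xi)
  * (w_poly L q (path_composition tau xi)).[a * b].

Definition TL_partition (a b q : R) : R :=
  \sum_(tau : config L) \sum_(xi : config L) TL_weight a b q tau xi.

Definition TL_prob (a b q : R) tau xi : R :=
  TL_weight a b q tau xi / TL_partition a b q.

End TwoLayer.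

(* Main.v *)
(* For |ab| < 1 the expansion of w_sigma, reindexed by m = n - min(gamma),
   turns the weight of a pair (tau, xi) into
     (ab; q)_(L+2) * \sum_m a^m b^(m + gamma_L) \prod_k [m + gamma_k + 1]_q,
   where heights m + gamma_k < 0 do not contribute.  Summing over xi is then a
   product of transfer operators D (site occupied) and E (site empty) on
   functions of the height, and these satisfy D E - q E D = D + E together with
   the two boundary relations of the matrix ansatz, so deleting one site at a
   time makes the master equation telescope.  No convergence is needed: for
   fixed b everything is an identity between formal power series in a, and the
   top marginal is a polynomial in a, hence the master equation holds for all
   a, b >= 0.  Uniqueness follows because the positive part of a signed
   stationary measure is stationary and every configuration leads to the empty
   one. *)
Require Import Defs.
From mathcomp Require Import all_boot all_order all_algebra.
From mathcomp Require Import perm.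
From mathcomp Require Import all_classical all_reals all_analysis.
From mathcomp Require Import ring lra zify.

Set Implicit Arguments.
Unset Strict Implicit.
Unset Printing Implicit Defensive.

Import Order.TTheory GRing.Theory Num.Theory.
Import numFieldNormedType.Exports.
Local Open Scope ring_scope.

(** * Formal power series of rational functions, handled through truncations *)

Section Represents.
Variable F : fieldType.
Implicit Types (d e p : {poly F}) (s : nat -> F).

(* [p] equals [d] times the formal power series of coefficients [s]. *)
Definition represents d p s :=
  forall N, 'X^N %| p - d * \poly_(i < N) s i.

Lemma eq_represents d p s t : s =1 t -> represents d p s -> represents d p t.
Proof.
move=> st ps N; have := ps N.
by under eq_poly => i _ do rewrite st.
Qed.

Lemma representsD d p1 p2 s1 s2 : represents d p1 s1 -> represents d p2 s2 ->
  represents d (p1 + p2) (fun n => s1 n + s2 n).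
Proof.
move=> h1 h2 N.
have -> : \poly_(i < N) (s1 i + s2 i) = \poly_(i < N) s1 i + \poly_(i < N) s2 i.
  by apply/polyP => i; rewrite coefD !coef_poly; case: ifP; rewrite ?addr0.
by rewrite mulrDr opprD addrACA dvdp_add.
Qed.

Lemma representsZ d p s c : represents d p s ->
  represents d (c *: p) (fun n => c * s n).
Proof.
move=> h N.
have -> : \poly_(i < N) (c * s i) = c *: \poly_(i < N) s i.
  by apply/polyP => i; rewrite coefZ !coef_poly; case: ifP; rewrite ?mulr0.
by rewrite -scalerAr -scalerBr -mul_polyC dvdp_mull.
Qed.

Lemma represents0 d : represents d 0 (fun=> 0).
Proof.
move=> N; have -> : \poly_(i < N) 0 = 0 :> {poly F}.
  by apply/polyP => i; rewrite coef_poly coef0 if_same.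
by rewrite mulr0 subr0 dvdp0.
Qed.

Lemma representsB d p1 p2 s1 s2 : represents d p1 s1 -> represents d p2 s2 ->
  represents d (p1 - p2) (fun n => s1 n - s2 n).
Proof.
move=> h1 /(representsZ (-1)); rewrite scaleN1r => /(representsD h1).
by apply: eq_represents => n; rewrite mulN1r.
Qed.

Lemma represents_sum d (I : Type) (r : seq I) (P : pred I)
    (p : I -> {poly F}) (s : I -> nat -> F) :
  (forall i, P i -> represents d (p i) (s i)) ->
  represents d (\sum_(i <- r | P i) p i) (fun n => \sum_(i <- r | P i) s i n).
Proof.
move=> h; elim: r => [|i r IH].
  rewrite big_nil; apply: eq_represents (represents0 d) => n.
  by rewrite big_nil.
rewrite big_cons; case: ifP => Pi; last first.
  by apply: eq_represents IH => n; rewrite big_cons Pi.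
by apply: eq_represents (representsD (h _ Pi) IH) => n; rewrite big_cons Pi.
Qed.

Lemma polyS_shift s N :
  \poly_(i < N.+1) s i = (s 0%N)%:P + 'X * \poly_(i < N) s i.+1.
Proof.
apply/polyP => -[|i]; rewrite coefD coefC coefXM !coef_poly /= ?addr0 //.
by rewrite add0r ltnS.
Qed.

Lemma representsXM d p s : represents d p s ->
  represents d ('X * p) (fun n => if n is m.+1 then s m else 0).
Proof.
move=> h [|N]; first by rewrite expr0 dvd1p.
by rewrite polyS_shift polyC0 add0r mulrCA -mulrBr exprS dvdp_mul.
Qed.

Lemma representsXnM d p s k : represents d p s ->
  represents d ('X^k * p) (fun n => if (k <= n)%N then s (n - k)%N else 0).
Proof.
move=> h; elim: k => [|k IH].
  by rewrite expr0 mul1r; apply: eq_represents h => n; rewrite subn0.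
rewrite exprS -mulrA; apply: eq_represents (representsXM IH) => -[|n] //.
Qed.

Lemma represents_divX d p s : s 0%N = 0 -> represents d ('X * p) s ->
  represents d p (fun n => s n.+1).
Proof.
move=> s0 h N; have := h N.+1.
rewrite polyS_shift s0 polyC0 add0r mulrCA -mulrBr exprS.
by rewrite dvdp_mul2l // polyX_eq0.
Qed.

Lemma representsM d e p s : represents d p s -> represents (e * d) (e * p) s.
Proof. by move=> h N; rewrite -mulrA -mulrBr dvdp_mull. Qed.

(** The substitution sends ['X^N] to [c ^+ N *: 'X^N], still a multiple of ['X^N], also when
    [c = 0]. It is applied with [c = q] and [c = b], both of which may vanish. *)
Lemma represents_comp d p s c : represents d p s ->
  represents (d \Po (c *: 'X)) (p \Po (c *: 'X)) (fun n => c ^+ n * s n).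
Proof.
move=> h N; have /dvdpP[u uE] := h N.
have -> : \poly_(i < N) (c ^+ i * s i) = (\poly_(i < N) s i) \Po (c *: 'X).
  rewrite !poly_def rmorph_sum; apply: eq_bigr => i _ /=.
  by rewrite comp_polyZ rmorphXn /= comp_polyX exprZn scalerA mulrC.
rewrite -comp_polyM -comp_polyB uE comp_polyM rmorphXn /= comp_polyX.
rewrite exprZn -scalerAr.
by rewrite -[_ ^+ _ *: _]mul_polyC mulrA dvdp_mull.
Qed.

Lemma represents_coef0 d p s : represents d p s -> p`_0 = d`_0 * s 0%N.
Proof.
move/(_ 1%N); rewrite expr1 -[X in X %| _]subr0 -[X in 'X - X]polyC0.
rewrite dvdp_XsubCl polyS_shift poly_def big_ord0 mulr0 addr0.
by rewrite /root !hornerE subr_eq0 !horner_coef0 => /eqP.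
Qed.

(** A nonzero [p] has degree below [size p], so it is not a multiple of ['X^(size p)]. This turns
    vanishing series coefficients back into a polynomial identity. *)
Lemma represents_eq0 d p : represents d p (fun=> 0) -> p = 0.
Proof.
move/(_ (size p)).
have -> : \poly_(i < size p) 0 = 0 :> {poly F}.
  by apply/polyP => i; rewrite coef_poly coef0 if_same.
rewrite mulr0 subr0 => h; apply/eqP/negPn/negP => p0.
by have := dvdp_leq p0 h; rewrite size_polyXn ltnn.
Qed.

End Represents.

(** * Jackson derivatives of fractions over q-Pochhammer products *)

Section QForm.
Variable R : realType.
Variable q : R.
Hypotheses (q_ge0 : 0 <= q) (q_lt1 : q < 1).
Local Notation "p %:F" := (@tofrac {poly R} p).

Definition qnum (n : nat) : R := \sum_(i < n) q ^+ i.

Lemma qnum0 : qnum 0 = 0.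
Proof. exact: big_ord0. Qed.

Lemma qnumS n : qnum n.+1 = 1 + q * qnum n.
Proof.
rewrite /qnum big_ord_recl expr0 mulr_sumr; congr (_ + _).
by apply: eq_bigr => i _; rewrite exprS.
Qed.

Lemma qnumE n : (1 - q) * qnum n = 1 - q ^+ n.
Proof.
elim: n => [|n IH]; first by rewrite qnum0 mulr0 expr0 subrr.
by rewrite qnumS exprS mulrDr mulrCA IH; ring.
Qed.

Lemma qnum_ge0 n : 0 <= qnum n.
Proof. by apply: sumr_ge0 => i _; apply: exprn_ge0. Qed.

Lemma qnum_gt0 n : 0 < qnum n.+1.
Proof. by rewrite qnumS ltr_pwDl // mulr_ge0 // qnum_ge0. Qed.

(** Keeps together the closed form of a fraction, its Taylor coefficients [s] and the sign of its
    numerator. The size bound [m] is carried along because [jackson_num] has nonnegative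
    coefficients and the right value only under a degree bound. *)
Definition qform n m (f : {fraction {poly R}}) (s : nat -> R) :=
  exists w : {poly R}, [/\ f = w%:F / (qpoch q n)%:F, (size w <= m)%N,
    forall k, 0 <= w`_k & represents (qpoch q n) w s].

Lemma eq_qform n m f s t : s =1 t -> qform n m f s -> qform n m f t.
Proof.
by move=> st [w [fE sw w0 h]]; exists w; split=> //; apply: eq_represents h.
Qed.

Lemma qpochSl n : (1 - 'X) * (qpoch q n \Po (q *: 'X)) = qpoch q n.+1.
Proof.
rewrite /qpoch [RHS]big_ord_recl expr0 scale1r rmorph_prod; congr (_ * _).
apply: eq_bigr => i _; rewrite rmorphB rmorph1 /= comp_polyZ comp_polyX.
by rewrite scalerA -exprSr.
Qed.

Lemma qpochSr n : (1 - q ^+ n *: 'X) * qpoch q n = qpoch q n.+1.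
Proof. by rewrite mulrC /qpoch big_ord_recr. Qed.

Lemma qpoch_neq0 n : qpoch q n != 0.
Proof.
apply/eqP => /(congr1 (horner^~ 0)); rewrite qpoch0 horner0.
exact/eqP/oner_neq0.
Qed.

(* The numerator of [jackson q (w / qpoch q n)] over [qpoch q n.+1]; the
   coefficients are visibly nonnegative as long as the degree of [w] is at most
   [n]. *)
Definition jackson_num n (w : {poly R}) : {poly R} :=
  \poly_(k < n.+1) (qnum k.+1 * w`_k.+1 + q ^+ k * qnum (n - k) * w`_k).

(** Compare coefficients of degree [k.+1]: [(1 - q) * qnum k.+1 = 1 - q ^+ k.+1] and [q ^+ k * (1 -
    q) * qnum (n - k) = q ^+ k - q ^+ n]. Beyond degree [n.+1] both sides vanish by the size
    bound. *)
Lemma jackson_numE n (w : {poly R}) : (size w <= n.+1)%N ->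
  'X * ((1 - q) *: jackson_num n w) =
  (1 - q ^+ n *: 'X) * w - (1 - 'X) * (w \Po (q *: 'X)).
Proof.
move=> sw.
have wq k : (w \Po (q *: 'X))`_k = q ^+ k * w`_k.
  rewrite -[in LHS](coefK w) poly_def rmorph_sum coef_sum /=.
  have -> : w`_k = \sum_(i < size w) w`_i * (k == i)%:R.
    rewrite -[in LHS](coefK w) poly_def coef_sum; apply: eq_bigr => i _.
    by rewrite coefZ coefXn.
  rewrite mulr_sumr; apply: eq_bigr => i _.
  rewrite comp_polyZ rmorphXn /= comp_polyX exprZn !coefZ coefXn.
  by case: eqP => [->|_]; rewrite ?mulr0 // !mulr1 mulrC.
apply/polyP => -[|k].
  rewrite coefXM !mulrBl !coefB !mul1r -scalerAl coefZ !coefXM wq expr0.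
  by rewrite coefZ coefXM /= mulr0 !subr0 mul1r subrr.
rewrite coefXM !mulrBl !coefB !mul1r -scalerAl !coefZ !coefXM !wq /= coef_poly.
case: ltnP => kn; last first.
  by rewrite !nth_default ?mulr0 ?subr0 ?subrr // (leq_trans sw) // ltnW.
have e := qnumE (n - k); have e1 := qnumE k.+1.
have e2 : q ^+ n = q ^+ k * q ^+ (n - k) by rewrite -exprD subnKC.
have -> : (1 - q) * (qnum k.+1 * w`_k.+1 + q ^+ k * qnum (n - k) * w`_k) =
    (1 - q) * qnum k.+1 * w`_k.+1 + q ^+ k * ((1 - q) * qnum (n - k)) * w`_k.
  by ring.
by rewrite e e1 e2; ring.
Qed.

(** On series the Jackson derivative sends [z ^ k.+1] to [qnum k.+1] times [z ^ k]. *)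
Lemma jackson_qform n f s : qform n.+1 n.+2 f s ->
  qform n.+2 n.+2 (jackson q f) (fun k => qnum k.+1 * s k.+1).
Proof.
move=> [w [-> sw w0 h]]; exists (jackson_num n.+1 w).
have q1 : 1 - q != 0 by rewrite subr_eq0 gt_eqF.
have e := jackson_numE sw.
split; last 1 first.
(* Over the common denominator [qpoch q n.+2], [f] minus its dilation has coefficients
   [(1 - q ^+ k) * s k]. The one at [k = 0] vanishes, so ['X] can be cancelled. *)
- have h1 := representsM (1 - q ^+ n.+1 *: 'X) h.
  have h2 := representsM (1 - 'X) (represents_comp q h).
  rewrite qpochSr in h1; rewrite qpochSl in h2.
  have := representsB h1 h2; rewrite -e => /represents_divX.
  rewrite expr0 mul1r subrr => /(_ erefl)/(representsZ (1 - q)^-1).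
  rewrite scalerA mulVf // scale1r; apply: eq_represents => k.
  rewrite -[X in _ * (X - _)]mul1r -mulrBl -qnumE !mulrA mulVf //.
  by rewrite mul1r.
- rewrite /jackson dilateE ?qpoch0 ?oner_neq0 //.
  apply: (@frac_step _ _ _ _ _ ((1 - q ^+ n.+1 *: 'X)%:F) ((1 - 'X)%:F)
    _ (((1 - q ^+ n.+1 *: 'X) * w - (1 - 'X) * (w \Po (q *: 'X)))%:F)).
  + by rewrite -!tofracM -tofracB mulrC [X in _ - X]mulrC.
  + by rewrite -tofracM mulrC qpochSr.
  + by rewrite -tofracM qpochSl.
  + by rewrite tofrac_eq0 qpoch_neq0.
  + by rewrite tofrac_eq0 mulf_neq0 ?polyX_eq0 ?polyC_eq0.
  + by rewrite -e -tofracM -mulrA mul_polyC.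
- exact: size_poly.
- move=> k; rewrite coef_poly; case: ifP => // _.
  by rewrite addr_ge0 ?mulr_ge0 ?qnum_ge0 ?exprn_ge0.
Qed.

(** Multiplying by ['X] first uses up the spare degree allowed by [jackson_qform] and undoes the
    index shift. *)
Lemma jacksonX_qform n f s : qform n.+1 n.+1 f s ->
  qform n.+2 n.+2 (jacksonX q f) (fun k => qnum k.+1 * s k).
Proof.
move=> [w [-> sw w0 h]].
apply: (@jackson_qform n _ (fun k => if k is k'.+1 then s k' else 0)).
exists ('X * w); split; last exact: representsXM h.
- by rewrite tofracM mulrA.
- by rewrite mulrC (leq_trans (size_polyMleq _ _)) // size_polyX addn2.
- by case=> [|k]; rewrite coefXM /=.
Qed.

(** Each plain derivative shifts the index and contributes [qnum n.+1]; each derivative preceded by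
    a multiplication by [z] contributes [qnum n.+1] without a shift. A part [s] thus yields one
    shift and the power [s]. The induction starts from the geometric series. *)
Lemma foldr_qform (sigma : seq nat) : all (leq 1) sigma ->
  qform (sumn sigma).+1 (sumn sigma).+1
    (foldr (fun s f => iter s.-1 (jacksonX q) (jackson q f))
        (1 / (1 - 'X)%:F) sigma)
    (fun n => \prod_(j < size sigma) qnum (n + j).+1 ^+ nth 0%N sigma j).
Proof.
elim: sigma => [_|s sigma IH /= /andP[s0 /IH{}IH]].
  exists 1; split.
  - by rewrite tofrac1 /= /qpoch big_ord1 expr0 scale1r.
  - by rewrite size_poly1.
  - by move=> k; rewrite coef1; case: eqP.
  move=> N; rewrite /qpoch big_ord1 expr0 scale1r.
  under eq_poly => i _ do rewrite big_ord0.
  have -> : (1 - 'X) * \poly_(i < N) (1 : R) = 1 - 'X^N.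
    elim: N => [|N IH]; first by rewrite poly_def big_ord0 mulr0 expr0 subrr.
    by rewrite polyS_shift mulrDr mulr1 mulrCA IH exprS; ring.
  by rewrite subKr.
case: s s0 => // s _ /=.
apply: (@eq_qform _ _ _ (fun n => qnum n.+1 ^+ s *
  (qnum n.+1 * \prod_(j < size sigma) qnum (n.+1 + j).+1 ^+ nth 0%N sigma j))).
  move=> n; rewrite big_ord_recl /= addn0 exprSr -mulrA.
  by congr (_ * (_ * _)); apply: eq_bigr => i _; rewrite addSnnS.
elim: s => [|s IHs].
  have /jackson_qform : qform (sumn sigma).+1 (sumn sigma).+2
    (foldr (fun s f => iter s.-1 (jacksonX q) (jackson q f))
        (1 / (1 - 'X)%:F) sigma)
    (fun n => \prod_(j < size sigma) qnum (n + j).+1 ^+ nth 0%N sigma j).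
    by have [w [? sw ? ?]] := IH; exists w; split=> //; apply: leqW.
  by apply: eq_qform => n; rewrite expr0 mul1r.
rewrite iterS; apply: eq_qform (jacksonX_qform IHs) => n.
by rewrite exprS -!mulrA.
Qed.

Lemma w_poly_represents L sigma : all (leq 1) sigma -> sumn sigma = L.+1 ->
  represents (qpoch q L.+2) (w_poly L q sigma)
    (fun n => \prod_(j < size sigma) qnum (n + j).+1 ^+ nth 0%N sigma j) /\
  forall k, 0 <= (w_poly L q sigma)`_k.
Proof.
move=> s1 sL; have := foldr_qform s1; rewrite sL => -[w [fE _ w0 h]].
suff -> : w_poly L q sigma = w by split.
apply/eqP; rewrite -tofrac_eq w_polyE // /w_frac fE mulrCA divff ?mulr1 //.
by rewrite tofrac_eq0 qpoch_neq0.
Qed.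

Lemma w_poly_ge0 L sigma z : all (leq 1) sigma -> sumn sigma = L.+1 ->
  0 <= z -> 0 <= (w_poly L q sigma).[z].
Proof.
move=> s1 sL z0; have [_ w0] := w_poly_represents s1 sL.
by rewrite horner_coef sumr_ge0 // => i _; rewrite mulr_ge0 ?exprn_ge0.
Qed.

(** The constant coefficient is a product of powers of positive q-integers, and the other
    coefficients are nonnegative. *)
Lemma w_poly_gt0 L sigma z : all (leq 1) sigma -> sumn sigma = L.+1 ->
  0 <= z -> 0 < (w_poly L q sigma).[z].
Proof.
move=> s1 sL z0; have [/represents_coef0 c0 w0] := w_poly_represents s1 sL.
have : 0 < (w_poly L q sigma)`_0.
  rewrite c0 -horner_coef0 qpoch0 mul1r prodr_gt0 // => i _.
  by rewrite exprn_gt0 ?qnum_gt0.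
case E : (size (w_poly L q sigma)) => [|n].
  by rewrite nth_default ?E ?ltxx.
rewrite horner_coef E big_ord_recl expr0 mulr1 => c0_gt0.
by rewrite ltr_pwDl // sumr_ge0 // => i _; rewrite mulr_ge0 ?exprn_ge0.
Qed.

End QForm.

(** * Heights of a lattice path and its level composition *)

Section Paths.
Variable L : nat.
Variables tau xi : config L.
Local Notation h := (path_height tau xi).
Local Notation hmin := (path_min tau xi).
Local Notation hmax := (path_max tau xi).

Lemma path_height0 : h 0 = 0.
Proof. by rewrite /path_height big_pred0_eq. Qed.

Lemma path_heightS k : `|h k.+1 - h k| <= 1.
Proof.
rewrite /path_height.
have -> : \sum_(j < L | (j < k.+1)%N) ((tau j)%:Z - (xi j)%:Z) =
  \sum_(j < L | (j < k)%N) ((tau j)%:Z - (xi j)%:Z) +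
  \sum_(j < L | j == k :> nat) ((tau j)%:Z - (xi j)%:Z).
  rewrite (bigID (fun j : 'I_L => (j < k)%N)) /=; congr (_ + _);
    apply: eq_bigl => j; lia.
rewrite addrAC subrr add0r; have [kL|kL] := ltnP k L.
  rewrite (big_pred1 (Ordinal kL)) => [|j /=]; last by rewrite -val_eqE.
  by case: (tau _) (xi _) => -[].
rewrite big_pred0 ?normr0 // => j; apply/negbTE; have := ltn_ord j; lia.
Qed.

Lemma path_min_le k : (k <= L)%N -> hmin <= h k.
Proof.
move=> kL.
exact: (bigmin_le _ (Ordinal (kL : (k < L.+1)%N)) (fun k => h k)).
Qed.

Lemma path_max_ge k : (k <= L)%N -> h k <= hmax.
Proof.
move=> kL; pose i : 'I_L.+1 := Ordinal (kL : (k < L.+1)%N).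
exact: (le_bigmax _ (fun k : 'I_L.+1 => h k) i).
Qed.

Lemma path_min_attained : exists2 k, (k <= L)%N & hmin = h k.
Proof.
rewrite /path_min; elim/big_ind: _ => [|x y [i iL ->] [j jL ->]|i _].
- by exists 0%N => //; rewrite path_height0.
- by rewrite minEle; case: ifP => _; [exists i | exists j].
- by exists i => //; rewrite -ltnS.
Qed.

Lemma path_max_attained : exists2 k, (k <= L)%N & hmax = h k.
Proof.
rewrite /path_max; elim/big_ind: _ => [|x y [i iL ->] [j jL ->]|i _].
- by exists 0%N => //; rewrite path_height0.
- by rewrite maxEle; case: ifP => _; [exists j | exists i].
- by exists i => //; rewrite -ltnS.
Qed.

Lemma path_min_le0 : hmin <= 0.
Proof. by have := path_min_le (leq0n L); rewrite path_height0. Qed.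

(** Steps of size at most 1 cannot jump over [v]: a path avoiding [v] stays on the side where it
    starts and misses its maximum or its minimum. *)
Lemma path_ivt v : hmin <= v -> v <= hmax -> exists2 k, (k <= L)%N & h k = v.
Proof.
move=> minv vmax; apply: contrapT => nv.
have hv k : (k <= L)%N -> h k != v.
  by move=> kL; apply/eqP => e; apply: nv; exists k.
have [i iL ei] := path_min_attained; have [j jL ej] := path_max_attained.
have [h0v|vh0] := ltP (h 0) v.
  suff : h j < v by lia.
  elim: j jL {ej} => // j IH jL; have := IH (ltnW jL).
  by have := hv _ jL; have := path_heightS j; lia.
suff : v < h i by lia.
elim: i iL {ei} => [|i IH] iL; first by have := hv 0%N isT; lia.
by have := IH (ltnW iL); have := hv _ iL; have := path_heightS i; lia.
Qed.

Local Notation r := (`|hmax - hmin|%N).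

(** The parts of the composition are the fibre sizes of this map, which reduces their sum and the
    products over times to [partition_big]. *)
Definition path_level (k : 'I_L.+1) : 'I_r.+1 := inord `|h k - hmin|.

Lemma path_levelE k (i : 'I_r.+1) :
  (path_level k == i) = (h k == hmin + i%:Z).
Proof.
have kL : (k <= L)%N by rewrite -ltnS.
have := path_min_le kL; have := path_max_ge kL; rewrite -val_eqE /= => h1 h2.
rewrite inordK; last by lia.
lia.
Qed.

Lemma size_path_composition : size (path_composition tau xi) = r.+1.
Proof. exact: size_mkseq. Qed.

Lemma nth_path_composition (i : 'I_r.+1) :
  nth 0%N (path_composition tau xi) i = #|[set k | path_level k == i]|.
Proof.
rewrite nth_mkseq //; by apply: eq_card => k; rewrite !inE path_levelE.
Qed.

Lemma path_composition_ge1 : all (leq 1) (path_composition tau xi).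
Proof.
apply/(all_nthP 0%N) => i; rewrite size_path_composition => ir.
rewrite (nth_path_composition (Ordinal ir)) card_gt0; apply/set0Pn.
have hmin0 := path_min_le0.
have := path_max_ge (leq0n L); rewrite path_height0 => hmax0.
have [k kL hk] : exists2 k, (k <= L)%N & h k = hmin + i%:Z.
  by apply: path_ivt; lia.
by exists (Ordinal (kL : (k < L.+1)%N)); rewrite inE path_levelE hk.
Qed.

Lemma sumn_path_composition : sumn (path_composition tau xi) = L.+1.
Proof.
rewrite sumnE (big_nth 0%N) size_path_composition big_mkord.
rewrite -[RHS]card_ord -sum1_card (partition_big path_level predT) //=.
apply: eq_bigr => i _; rewrite nth_path_composition -sum1_card.
by apply: eq_bigl => k; rewrite inE.
Qed.

Lemma path_prod (R : comPzRingType) (g : nat -> R) :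
  \prod_(k < L.+1) g `|h k - hmin|%N =
  \prod_(j < size (path_composition tau xi))
     g j ^+ nth 0%N (path_composition tau xi) j.
Proof.
rewrite size_path_composition (partition_big path_level predT) //=.
apply: eq_bigr => i _; rewrite nth_path_composition -prodr_const.
apply: eq_big => [k|k]; first by rewrite inE.
rewrite path_levelE => /eqP ->; congr (g _); lia.
Qed.

End Paths.

(** * Summation over the bottom layer by transfer operators *)

Section Layers.
Variables (R : realType) (q b : R).

(* [qint] vanishes at the negative integers too, so a path that reaches a
   negative height gets weight 0. *)
Definition qint (z : int) : R := if z is Posz n then qnum q n else 0.

(** The operator D for [c = true] and E for [c = false]: [m] is the height before the site, and the
    two summands are the two bottom occupations, one equal to [c] and one different. *)
Definition layer_step (c : bool) (f : int -> R) (m : int) : R :=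
  qint (m + 1) * (f m + f (m + (if c then 1 else -1))).

(** The absolute value only makes the exponent a natural number: for [m < 0] the factor
    [qint (m + 1)] is 0. *)
Definition layer_end (m : int) : R := qint (m + 1) * b ^+ `|m|.

Definition layer (s : seq bool) : int -> R := foldr layer_step layer_end s.

Definition config_cons L (c : bool) (x : config L) : config L.+1 :=
  [ffun i => if unlift ord0 i is Some j then x j else c].

Lemma config_sum_recl L (F : config L.+1 -> R) :
  \sum_xi F xi = \sum_c \sum_x F (config_cons c x).
Proof.
rewrite pair_big /= (reindex (fun p => config_cons p.1 p.2)) //=.
apply: onW_bij; exists (fun xi : config L.+1 =>
  (xi ord0, [ffun j => xi (lift ord0 j)] : config L)).
  move=> [c x] /=; rewrite ffunE unlift_none; congr (_, _).
  by apply/ffunP => j; rewrite !ffunE liftK.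
move=> xi; apply/ffunP => i; rewrite ffunE /=.
by case: unliftP => [j|] ->; rewrite ?ffunE.
Qed.

(** The top layer is a list here, so that sites can be peeled off or deleted one at a time. *)
Definition seq_height L (s : seq bool) (xi : config L) (k : nat) : int :=
  \sum_(j < L | (j < k)%N) ((nth false s j)%:Z - (xi j)%:Z).

Lemma layer_sum L s m : size s = L ->
  \sum_(xi : config L)
     b ^+ `|m + seq_height s xi L| *
     \prod_(k < L.+1) qint (m + seq_height s xi k + 1) = layer s m.
Proof.
elim: L s m => [|L IH] [|c s] m //=.
  move=> _; rewrite (big_pred1 [ffun=> false]) => [|xi].
    by rewrite big_ord1 /seq_height !big_ord0 !addr0 mulrC.
  by apply/esym/eqP/ffunP => -[].
move=> [sL]; rewrite config_sum_recl.
have hS e x k : seq_height (c :: s) (config_cons e x) k.+1 =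
    c%:Z - e%:Z + seq_height s x k.
  rewrite /seq_height big_mkcond big_ord_recl /= ffunE unlift_none.
  congr (_ + _).
  rewrite [RHS]big_mkcond; apply: eq_bigr => j _; rewrite ltnS.
  by case: ifP => //; rewrite ffunE liftK.
have h0 e x : seq_height (c :: s) (config_cons e x) 0 = 0.
  by rewrite /seq_height big_pred0_eq.
transitivity (\sum_(e : bool) qint (m + 1) * layer s (m + (c%:Z - e%:Z))).
  apply: eq_bigr => e _; rewrite -IH // mulr_sumr; apply: eq_bigr => x _.
  rewrite hS [in LHS]big_ord_recl h0 addr0 mulrCA !addrA.
  congr (_ * (_ * _)).
  by apply: eq_bigr => k _; rewrite lift0 hS !addrA.
rewrite big_bool /layer_step /= -mulrDr; congr (_ * _).
case: c {hS h0} => /=; rewrite ?subr0 ?sub0r ?subrr ?addr0 //.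
by rewrite addrC.
Qed.

End Layers.

(** * The weights as polynomials in [a], with their series expansions *)

Section WeightPolynomial.
Variables (R : realType) (q b : R) (L : nat).
Implicit Types tau xi : config L.

Definition config_seq tau : seq bool := [seq tau i | i <- enum 'I_L].

Lemma size_config_seq tau : size (config_seq tau) = L.
Proof. by rewrite size_map size_enum_ord. Qed.

Lemma nth_config_seq tau (i : 'I_L) : nth false (config_seq tau) i = tau i.
Proof. by rewrite (nth_map i) ?size_enum_ord // nth_ord_enum. Qed.

Lemma seq_heightE tau xi : seq_height (config_seq tau) xi = path_height tau xi.
Proof.
by apply/funext => k; apply: eq_bigr => j _; rewrite nth_config_seq.
Qed.

(* [TL_weight a b q tau xi] as a polynomial in [a]. *)
Definition TL_poly tau xi : {poly R} :=
  b ^+ `|path_height tau xi L - path_min tau xi| *: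
    ('X^`|path_min tau xi| *
     (w_poly L q (path_composition tau xi) \Po (b *: 'X))).

Lemma horner_TL_poly a tau xi : (TL_poly tau xi).[a] = TL_weight a b q tau xi.
Proof.
rewrite /TL_poly /TL_weight hornerZ hornerM hornerXn horner_comp.
rewrite hornerZ hornerX.
rewrite mulrA [a * b]mulrC; congr (_ * _); rewrite mulrC; congr (_ * _).
  have := path_min_le0 tau xi; case: (path_min _ _) => [[|n]|n] //=.
have := path_min_le tau xi (leqnn L).
case E : (path_height tau xi L - path_min tau xi) => [n|n] //=; lia.
Qed.

Definition top_poly tau : {poly R} := \sum_xi TL_poly tau xi.

Lemma horner_top_poly a tau :
  (top_poly tau).[a] = \sum_xi TL_weight a b q tau xi.
Proof.
by rewrite horner_sum; apply: eq_bigr => xi _; rewrite horner_TL_poly.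
Qed.

Hypotheses (q_ge0 : 0 <= q) (q_lt1 : q < 1).

Lemma TL_poly_represents tau xi :
  represents (qpoch q L.+2 \Po (b *: 'X)) (TL_poly tau xi)
    (fun n => b ^+ `|n%:Z + path_height tau xi L| *
              \prod_(k < L.+1) qint q (n%:Z + path_height tau xi k + 1)).
Proof.
have [h _] := w_poly_represents q_ge0 q_lt1 (path_composition_ge1 tau xi)
  (sumn_path_composition tau xi).
have := representsZ (b ^+ `|path_height tau xi L - path_min tau xi|)
  (representsXnM `|path_min tau xi| (represents_comp b h)).
apply: eq_represents => n /=.
have m0 := path_min_le0 tau xi.
have mL := path_min_le tau xi (leqnn L).
case: leqP => [le|lt]; last first.
  (* Below [|path_min|] the power of ['X] makes the left coefficient 0; on the right, the time at
     which the minimum is attained contributes a zero q-integer. *)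
  have [k kL mk] := path_min_attained tau xi.
  rewrite mulr0 (bigD1 (Ordinal (kL : (k < L.+1)%N))) //= -mk.
  have : n%:Z + path_min tau xi + 1 <= 0 by lia.
  by case: (_ + _ + 1) => [[|//]|i] _; rewrite /= ?qnum0 mul0r mulr0.
rewrite mulrA -exprD; congr (b ^+ _ * _); first by lia.
rewrite -(path_prod tau xi (fun j => qnum q (n - `|path_min tau xi| + j).+1)).
apply: eq_bigr => k _; have := path_min_le tau xi (ltn_ord k : (k <= L)%N).
move=> hk; rewrite /qint.
have -> : n%:Z + path_height tau xi k + 1 =
   (n - `|path_min tau xi| + `|path_height tau xi k - path_min tau xi|).+1%:Z.
  by lia.
by [].
Qed.

Lemma top_poly_represents tau :
  represents (qpoch q L.+2 \Po (b *: 'X)) (top_poly tau)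
    (fun n => layer q b (config_seq tau) n).
Proof.
have := represents_sum (index_enum (config L))
  (fun xi (_ : true) => TL_poly_represents tau xi).
apply: eq_represents => n /=.
rewrite -(layer_sum q b n (size_config_seq tau)).
by apply: eq_bigr => xi _; rewrite seq_heightE.
Qed.

Lemma TL_weight_ge0 a tau xi : 0 <= a -> 0 <= b -> 0 <= TL_weight a b q tau xi.
Proof.
move=> a0 b0; rewrite /TL_weight !mulr_ge0 ?exprz_ge0 //.
apply: w_poly_ge0; rewrite ?mulr_ge0 ?path_composition_ge1 //.
exact: sumn_path_composition.
Qed.

Lemma TL_partition_gt0 a : 0 <= a -> 0 <= b -> 0 < TL_partition L a b q.
Proof.
(* Both layers empty give a flat path at height 0, whose weight is [w_poly] alone. *)
move=> a0 b0; pose o : config L := [ffun=> false].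
have h0 k : path_height o o k = 0.
  by rewrite /path_height big1 // => j _; rewrite subrr.
have m0 : path_min o o = 0 by have [k _ ->] := path_min_attained o o.
rewrite /TL_partition (bigD1 o) //= (bigD1 o) //=.
rewrite ltr_pwDl // ?ltr_pwDl ?sumr_ge0 // => [|xi _|tau _]; last 2 first.
- exact: TL_weight_ge0.
- by apply: sumr_ge0 => xi _; apply: TL_weight_ge0.
rewrite /TL_weight h0 m0 subrr oppr0 !expr0z !mul1r.
apply: w_poly_gt0; rewrite ?mulr_ge0 ?path_composition_ge1 //.
exact: sumn_path_composition.
Qed.

End WeightPolynomial.

(** * The quadratic and boundary relations of the matrix ansatz *)

Section Algebra.
Variables (R : realType) (q b : R).
Implicit Types (f : int -> R) (s t : seq bool).
Local Notation step := (layer_step q).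
Local Notation layer := (layer q b).

Lemma qintS m : 0 <= m -> qint q (m + 1) = 1 + q * qint q m.
Proof. by case: m => // n _; rewrite -PoszD addn1 /= qnumS. Qed.

Lemma qint_neg m : m < 0 -> qint q (m + 1) = 0.
Proof.
move=> m0; have : m + 1 <= 0 by lia.
by case: (m + 1) => [[|]|] //=; rewrite qnum0.
Qed.

Lemma layer_neg s m : m < 0 -> layer s m = 0.
Proof.
by case: s => [|c s] m0; rewrite /= /layer_end /layer_step qint_neg // mul0r.
Qed.

(** For [m < 0] every term carries the factor [qint q (m + 1) = 0]. For [m >= 0] the recursion of
    q-integers reduces the coefficients of [f (m + 1)], [f m], [f (m - 1)] to 1, 2, 1, up to that
    same factor. *)
Lemma step_exchange f m :
  step true (step false f) m - q * step false (step true f) m =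
  step true f m + step false f m.
Proof.
have [m0|/qint_neg e] := leP 0 m; last first.
  by rewrite /layer_step e; ring.
have e1 := qintS m0.
have e2 : qint q (m + 1 + 1) = 1 + q * qint q (m + 1) by apply: qintS; lia.
rewrite /layer_step /= !addrK ?subrK e2 e1; ring.
Qed.

(** Linearity in the function argument carries a relation through any prefix of sites to its
    left. *)
Lemma layer_step_sub c f g x y m :
  step c (fun m => x * f m - y * g m) m = x * step c f m - y * step c g m.
Proof. rewrite /layer_step; ring. Qed.

Lemma layer_exchange s t m :
  layer (s ++ [:: true, false & t]) m
    - q * layer (s ++ [:: false, true & t]) m =
  layer (s ++ true :: t) m + layer (s ++ false :: t) m.
Proof.
elim: s m => [|c s IH] m /=; first exact: step_exchange.
transitivity (layer_step q c (fun m => 1 * layer (s ++ [:: true, false & t]) m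
    - q * layer (s ++ [:: false, true & t]) m) m).
  by rewrite layer_step_sub mul1r.
rewrite /layer_step !mul1r !IH; ring.
Qed.

(** The right boundary relation [beta D - delta E = 1] on the end vector; it rests on
    [beta * b = 1 - beta]. *)
Lemma layer_right beta s m : beta != 0 -> b = (1 - beta) / beta ->
  beta * layer (rcons s true) m - q * (1 - beta) * layer (rcons s false) m =
  layer s m.
Proof.
move=> beta0 bE; elim: s m => [|c s IH] m /=; last first.
  transitivity (layer_step q c (fun m => beta * layer (rcons s true) m -
      q * (1 - beta) * layer (rcons s false) m) m).
    by rewrite layer_step_sub.
  by rewrite /layer_step !IH.
have [m0|m0] := leP 0 m; last first.
  by rewrite /layer_step /layer_end qint_neg //; ring.
have hb : beta * b = 1 - beta by rewrite bE mulrC divfK.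
have e1 := qintS m0.
have e2 : qint q (m + 1 + 1) = 1 + q * qint q (m + 1) by apply: qintS; lia.
have eb : b ^+ `|m + 1| = b ^+ `|m| * b.
  by rewrite -exprSr; congr (_ ^+ _); lia.
(* At [m = 0] the exponent [|m - 1|] is 1, not -1, but there [qint q m] vanishes. Multiplying by [b]
   instead of dividing covers [b = 0]. *)
have em : qint q m * b ^+ `|m - 1| * b = qint q m * b ^+ `|m|.
  case: m m0 {e1 e2 eb} => // -[|n] _; first by rewrite /= qnum0 !mul0r.
  by rewrite -mulrA -exprSr; congr (_ * _ ^+ _); lia.
rewrite /layer_step /layer_end subrK eb -hb.
transitivity (qint q (m + 1) *
  (beta * b ^+ `|m| * (qint q (m + 1) + qint q (m + 1 + 1) * b) -
   q * (beta * b * qint q (m + 1) * b ^+ `|m| +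
        beta * (qint q m * b ^+ `|m - 1| * b)))); first by ring.
rewrite em e2.
transitivity (qint q (m + 1) * b ^+ `|m| *
  (beta * (qint q (m + 1) - q * qint q m) + beta * b)); first by ring.
by rewrite hb e1; ring.
Qed.

(** The left boundary relation [E - q a D = 1 + a], read off at the coefficient of [a ^ m]:
    multiplication by [a] becomes the shift from [m] to [m - 1]. *)
Lemma layer_left s m : 0 <= m ->
  layer (false :: s) m - q * layer (true :: s) (m - 1) =
  layer s m + layer s (m - 1).
Proof. by move=> m0; rewrite /= /layer_step subrK (qintS m0); ring. Qed.

End Algebra.

(** * The adjoint of the generator as gain minus loss *)

Section Balance.
Variables (R : realType) (L : nat).
Implicit Types (x tau : config L) (p : config L -> R).

Lemma flipK j : involutive (@flip L j).
Proof.
by move=> x; apply/ffunP => i; rewrite !ffunE; case: eqP => // _; rewrite negbK.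
Qed.

Lemma swapK j k : involutive (@swap L j k).
Proof. by move=> x; apply/ffunP => i; rewrite !ffunE tpermK. Qed.

Definition bulk_rate (q : R) (j k : 'I_L) x : R :=
  if x j && ~~ x k then 1 else if ~~ x j && x k then q else 0.

Definition side_rate (a c : R) (j : 'I_L) x : R := if x j then c else a.

Definition gain_loss p (r : config L -> R) (T : config L -> config L) tau : R :=
  p (T tau) * r (T tau) - p tau * r tau.

(** Since [T] is an involution, [T tau] is the only configuration that it sends to [tau]. *)
Lemma sum_gain_loss p r T tau : involutive T ->
  \sum_x p x * (r x * ((T x == tau)%:R - (x == tau)%:R)) =
  gain_loss p r T tau.
Proof.
move=> TK; under eq_bigr do rewrite mulrA mulrBr.
rewrite sumrB; congr (_ - _).
  rewrite (bigD1 (T tau)) //= TK eqxx mulr1 big1 ?addr0 // => x xT.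
  case: eqP => [e|_]; last by rewrite mulr0.
  by move: xT; rewrite -e TK eqxx.
rewrite (bigD1 tau) //= eqxx mulr1 big1 ?addr0 // => x /negbTE->.
by rewrite mulr0.
Qed.

Lemma asep_adjoint q alpha beta gamma delta p tau :
  \sum_x p x * asep_generator q alpha beta gamma delta
                 (fun y => (y == tau)%:R) x =
    \sum_(j < L) \sum_(k < L | k == j.+1 :> nat)
      gain_loss p (bulk_rate q j k) (swap j k) tau
  + \sum_(j < L | j == 0%N :> nat)
      gain_loss p (side_rate alpha gamma j) (flip j) tau
  + \sum_(j < L | j.+1 == L)
      gain_loss p (side_rate delta beta j) (flip j) tau.
Proof.
rewrite /asep_generator; under eq_bigr do rewrite !mulrDr !mulr_sumr.
rewrite [LHS]big_split /= [X in X + _]big_split /=; congr (_ + _ + _).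
- rewrite exchange_big; apply: eq_bigr => j _ /=.
  under eq_bigr do rewrite mulr_sumr.
  rewrite exchange_big; apply: eq_bigr => k _ /=.
  exact: sum_gain_loss (@swapK j k).
- rewrite exchange_big; apply: eq_bigr => j _ /=.
  exact: sum_gain_loss (@flipK j).
- rewrite exchange_big; apply: eq_bigr => j _ /=.
  exact: sum_gain_loss (@flipK j).
Qed.

End Balance.

(** * Swaps, flips and deletions on words of occupation values *)

Section ConfigSeq.
Variable L : nat.
Implicit Types (tau : config L) (s : seq bool).

Definition delete_at (k : nat) s := take k s ++ drop k.+1 s.

Lemma config_seq_swap tau (j k : 'I_L) : k = j.+1 :> nat ->
  let s := config_seq tau in
  s = take j s ++ [:: tau j, tau k & drop k.+1 s] /\
  config_seq (swap j k tau) = take j s ++ [:: tau k, tau j & drop k.+1 s].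
Proof.
move=> kj s; have sz : size s = L by apply: size_config_seq.
have jL := ltn_ord j; have kL := ltn_ord k.
have sE : s = take j s ++ [:: tau j, tau k & drop k.+1 s].
  rewrite -[LHS](cat_take_drop j) (drop_nth false) ?sz // -{1}kj.
  by rewrite (drop_nth false) ?sz // !nth_config_seq.
split=> //; apply: (@eq_from_nth _ false).
  by rewrite size_config_seq -[LHS]sz [in LHS]sE !size_cat.
move=> i; rewrite size_config_seq => iL.
rewrite (nth_config_seq _ (Ordinal iL)) ffunE.
have szt : size (take j s) = j by rewrite size_takel // sz ltnW.
rewrite nth_cat szt.
case: tpermP => [e|e|/eqP nj /eqP nk].
- move/(congr1 val): e => /= ->.
  by rewrite ltnn subnn.
- move/(congr1 val): e => /= ->.
  by rewrite kj ltnNge leqnSn subSnn.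
rewrite -nth_config_seq -/s [in LHS]sE nth_cat szt /=; case: ltnP => // ji.
move: nj nk; rewrite -!val_eqE /= => nj nk.
by have -> : (i - j = (i - j - 2).+2)%N by lia.
Qed.

Lemma config_seq_flip_first tau (j : 'I_L) : j = 0 :> nat ->
  config_seq tau = tau j :: delete_at 0 (config_seq tau) /\
  config_seq (flip j tau) = ~~ tau j :: delete_at 0 (config_seq tau).
Proof.
move=> j0; have sz := size_config_seq tau; have jL := ltn_ord j.
have sE : config_seq tau = tau j :: delete_at 0 (config_seq tau).
  rewrite /delete_at take0 cat0s -nth_config_seq j0 -drop_nth ?drop0 //.
  by rewrite sz -j0.
split=> //; apply: (@eq_from_nth _ false).
  by rewrite size_config_seq -[LHS]sz [in LHS]sE.
move=> i; rewrite size_config_seq => iL.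
rewrite (nth_config_seq _ (Ordinal iL)) ffunE -val_eqE /= j0.
case: i iL => [|i] iL /=; first by congr (~~ tau _); apply: val_inj.
by rewrite -nth_config_seq [in LHS]sE.
Qed.

Lemma config_seq_flip_last tau (j : 'I_L) : j.+1 = L ->
  config_seq tau = rcons (delete_at j (config_seq tau)) (tau j) /\
  config_seq (flip j tau) = rcons (delete_at j (config_seq tau)) (~~ tau j).
Proof.
move=> jL; have sz := size_config_seq tau.
have dE : delete_at j (config_seq tau) = take j (config_seq tau).
  by rewrite /delete_at drop_oversize ?cats0 // sz jL.
have sE : config_seq tau = rcons (take j (config_seq tau)) (tau j).
  by rewrite -nth_config_seq -take_nth ?sz // jL take_oversize ?sz.
rewrite dE; split=> //; apply: (@eq_from_nth _ false).
  by rewrite size_config_seq -[LHS]sz [in LHS]sE !size_rcons.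
move=> i; rewrite size_config_seq => iL.
have szt : size (take j (config_seq tau)) = j by rewrite size_takel // sz ltnW.
rewrite (nth_config_seq _ (Ordinal iL)) ffunE -val_eqE /= nth_rcons szt.
have [ij|ij|ij] := ltngtP i j.
- by rewrite -nth_config_seq [in LHS]sE nth_rcons szt ij.
- by exfalso; lia.
- by congr (~~ tau _); apply: val_inj.
Qed.

Lemma delete_at_swap tau (j k : 'I_L) : k = j.+1 :> nat ->
  let s := config_seq tau in
  delete_at j s = take j s ++ tau k :: drop k.+1 s /\
  delete_at k s = take j s ++ tau j :: drop k.+1 s.
Proof.
move=> kj s; have sz : size s = L by apply: size_config_seq.
have kL := ltn_ord k; have jL := ltn_ord j; rewrite /delete_at.
rewrite -kj (drop_nth false) ?sz // nth_config_seq; split=> //.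
by rewrite kj (take_nth false) ?sz // nth_config_seq cat_rcons.
Qed.

End ConfigSeq.

(** * Telescoping of the bulk terms and the master equation *)

Lemma sum_succ_telescope (V : zmodType) n (f : nat -> V) : (0 < n)%N ->
  \sum_(j < n) \sum_(k < n | k == j.+1 :> nat) (f j - f k) = f 0%N - f n.-1.
Proof.
case: n => // n _; transitivity (\sum_(0 <= j < n) (f j - f j.+1)).
  rewrite big_mkord big_ord_recr /=.
  (* The last site has no right neighbour, so its inner sum is empty. *)
  rewrite [X in _ + X]big_pred0 ?addr0 => [|k]; last first.
    by apply/negbTE; rewrite neq_ltn ltn_ord.
  apply: eq_bigr => j _.
  have kL : (j.+1 < n.+1)%N by rewrite ltnS ltn_ord.
  by rewrite (big_pred1 (Ordinal kL)) => [|k /=]; last by rewrite -val_eqE.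
rewrite -[RHS]opprB -telescope_sumr // -sumrN.
by apply: eq_bigr => j _; rewrite opprB.
Qed.

Section MasterEquation.
Variables (R : realType) (q b : R) (L : nat) (tau : config L).
Local Notation s := (config_seq tau).
Local Notation weight m := (fun x : config L => layer q b (config_seq x) m).

(* The residue left by deleting site [k] with the quadratic relation. *)
Definition residue m k : R :=
  (-1) ^+ nth false s k * layer q b (delete_at k s) m.

(** Equal neighbours give 0 on both sides, since deleting either leaves the same word with the same
    sign. For distinct neighbours the exchange relation produces both deleted words, and the
    opposite signs in [residue] make them a difference. *)
Lemma bulk_gain_loss m (j k : 'I_L) : k = j.+1 :> nat ->
  gain_loss (weight m) (bulk_rate q j k) (swap j k) tau =
  residue m j - residue m k.
Proof.
move=> kj; have [s1 s2] := config_seq_swap tau kj.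
have [d1 d2] := delete_at_swap tau kj; rewrite /gain_loss /residue.
rewrite s2 [in X in _ - X]s1 d1 d2 !nth_config_seq.
rewrite /bulk_rate !ffunE tpermL tpermR.
have ex := layer_exchange q b (take j s) (drop k.+1 s) m.
case: (tau j); case: (tau k) => /=;
  rewrite ?mulr0 ?mulr1 ?expr0 ?expr1 ?subrr //.
  by lra.
by lra.
Qed.

Lemma bulk_sum m : (0 < L)%N ->
  \sum_(j < L) \sum_(k < L | k == j.+1 :> nat)
      gain_loss (weight m) (bulk_rate q j k) (swap j k) tau =
  residue m 0 - residue m L.-1.
Proof.
move=> L0; rewrite -sum_succ_telescope //.
apply: eq_bigr => j _; apply: eq_bigr => k /eqP kj.
by rewrite bulk_gain_loss // kj.
Qed.

Lemma right_gain_loss beta m (j : 'I_L) : beta != 0 -> b = (1 - beta) / beta ->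
  j.+1 = L ->
  gain_loss (weight m) (side_rate (q * (1 - beta)) beta j) (flip j) tau =
  residue m j.
Proof.
move=> beta0 bE jL; have [s1 s2] := config_seq_flip_last tau jL.
have h := layer_right q (delete_at j s) m beta0 bE.
rewrite /gain_loss /residue s2 [in X in _ - X]s1 nth_config_seq.
rewrite /side_rate ffunE eqxx.
case: (tau j) => /=; lra.
Qed.

Lemma left_gain_loss m (j : 'I_L) : 0 <= m -> j = 0 :> nat ->
  gain_loss (weight m) (side_rate 1 0 j) (flip j) tau +
  gain_loss (weight (m - 1)) (side_rate 0 q j) (flip j) tau =
  - (residue m 0 + residue (m - 1) 0).
Proof.
move=> m0 j0; have [s1 s2] := config_seq_flip_first tau j0.
have h := layer_left q b (delete_at 0 s) m0.
have e : nth false s 0 = tau j by rewrite -nth_config_seq j0.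
rewrite /gain_loss /residue e s2 [in X in _ - X + _]s1 [in X in _ + (_ - X)]s1.
rewrite /side_rate ffunE eqxx; move: h.
case: (tau j) => /= h; lra.
Qed.

(** The coefficient of [a ^ m] in [1 + a] times the master equation, because [(1 + a) * alpha = 1]
    and [(1 + a) * gamma = q * a]. The bulk terms telescope to end residues, which the reservoir
    terms cancel. *)
Lemma master_equation beta m : (0 < L)%N -> beta != 0 ->
  b = (1 - beta) / beta -> 0 <= m ->
  \sum_x weight m x * asep_generator q 1 beta 0 (q * (1 - beta))
                        (fun y => (y == tau)%:R) x +
  \sum_x weight (m - 1) x * asep_generator q 0 beta q (q * (1 - beta))
                        (fun y => (y == tau)%:R) x = 0.
Proof.
move=> L0 beta0 bE m0; rewrite !asep_adjoint !bulk_sum //.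
have lL : (L.-1 < L)%N by rewrite prednK.
have first (F : 'I_L -> R) :
    \sum_(j < L | j == 0%N :> nat) F j = F (Ordinal L0).
  by rewrite (big_pred1 (Ordinal L0)) // => j /=; rewrite -val_eqE.
have last (F : 'I_L -> R) : \sum_(j < L | j.+1 == L) F j = F (Ordinal lL).
  rewrite (big_pred1 (Ordinal lL)) // => j /=; rewrite -val_eqE /=.
  by have := ltn_ord j; lia.
rewrite !first !last !right_gain_loss //; last 2 first.
- by rewrite /= prednK.
- by rewrite /= prednK.
have := left_gain_loss m0 (erefl : Ordinal L0 = 0 :> nat).
move=> h /=; lra.
Qed.

End MasterEquation.

(** * Stationarity of the top marginal *)

Section TopLayer.
Variables (R : realType) (q : R) (L : nat).

(** The factor [1 + a] clears the denominator of [alpha], which makes the rates affine in [a], as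
    comparing coefficients requires. *)
Lemma asep_generator_left a alpha beta gamma delta f (x : config L) :
  (1 + a) * alpha = 1 -> gamma = q * (1 - alpha) ->
  (1 + a) * asep_generator q alpha beta gamma delta f x =
  asep_generator q 1 beta 0 delta f x + a * asep_generator q 0 beta q delta f x.
Proof.
move=> aE gE; rewrite /asep_generator !mulrDr.
have -> : (1 + a) * \sum_(j < L | j == 0%N :> nat)
      (if x j then gamma else alpha) * (f (flip j x) - f x) =
   \sum_(j < L | j == 0%N :> nat)
      (if x j then 0 else 1) * (f (flip j x) - f x) +
   a * \sum_(j < L | j == 0%N :> nat)
      (if x j then q else 0) * (f (flip j x) - f x).
  rewrite !mulr_sumr -big_split; apply: eq_bigr => j _ /=.
  rewrite !mulrA -mulrDl; congr (_ * _); case: (x j); last by rewrite aE; ring.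
  have -> : (1 + a) * gamma = q * (1 + a - (1 + a) * alpha) by rewrite gE; ring.
  by rewrite aE; ring.
by ring.
Qed.

Hypotheses (q_ge0 : 0 <= q) (q_lt1 : q < 1) (L_gt0 : (0 < L)%N).

Lemma top_poly_stationary a b alpha beta gamma delta tau :
  0 < alpha -> 0 < beta -> a = (1 - alpha) / alpha -> b = (1 - beta) / beta ->
  gamma = q * (1 - alpha) -> delta = q * (1 - beta) ->
  \sum_x (top_poly q b x).[a] *
    asep_generator q alpha beta gamma delta
      (fun y : config L => (y == tau)%:R) x = 0.
Proof.
move=> alpha0 beta0 aE bE gE ->.
have aalpha : (1 + a) * alpha = 1 by rewrite aE mulrDl divfK ?gt_eqF //; ring.
have a1 : 1 + a != 0.
  by apply: contra_eq_neq aalpha => ->; rewrite mul0r eq_sym oner_eq0.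
pose g1 x : R := asep_generator q 1 beta 0 (q * (1 - beta))
   (fun y : config L => (y == tau)%:R) x.
pose g2 x : R := asep_generator q 0 beta q (q * (1 - beta))
   (fun y : config L => (y == tau)%:R) x.
(* [g1] and [g2] do not involve [a], so [a] may become the indeterminate; the series coefficients
   then vanish by [master_equation]. *)
have T0 : \sum_x g1 x *: top_poly q b x +
          'X * \sum_x g2 x *: top_poly q b x = 0.
  apply: (@represents_eq0 _ (qpoch q L.+2 \Po (b *: 'X))).
  have rep (g : config L -> R) := represents_sum (index_enum (config L))
    (fun x (_ : true) =>
       representsZ (g x) (top_poly_represents b q_ge0 q_lt1 x)).
  apply: eq_represents (representsD (rep g1) (representsXM (rep g2))) => n /=.
  rewrite -[RHS](@master_equation _ q b L tau beta n%:Z) ?gt_eqF //.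
  congr (_ + _); first by apply: eq_bigr => x _; rewrite mulrC.
  (* The product by ['X] has no constant term; this matches the weight at height -1, which is 0. *)
  case: n => [|n]; last first.
    by apply: eq_bigr => x _; rewrite mulrC -addn1 PoszD addrK.
  by rewrite big1 // => x _; rewrite layer_neg ?mul0r.
apply: (mulfI a1); rewrite mulr0 -[RHS](horner0 a) -T0 hornerD hornerM hornerX.
rewrite !horner_sum !mulr_sumr -big_split; apply: eq_bigr => x _ /=.
rewrite mulrCA asep_generator_left // !hornerZ -/(g1 x) -/(g2 x); ring.
Qed.

End TopLayer.

(** * Uniqueness for a finite rate matrix with a state reachable from everywhere *)

Section Uniqueness.
Variables (R : realDomainType) (T : finType) (A : T -> T -> R) (o : T).
Hypothesis A_ge0 : forall x y, x != y -> 0 <= A x y.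
Hypothesis A_sum : forall x, \sum_y A x y = 0.
Hypothesis A_connect : forall x, connect (fun x y => 0 < A x y) x o.

Definition stationary (nu : T -> R) := forall y, \sum_x nu x * A x y = 0.

Lemma stationaryN nu : stationary nu -> stationary (fun x => - nu x).
Proof.
move=> h y; under eq_bigr do rewrite mulNr.
by rewrite sumrN h oppr0.
Qed.

(* Truncating a signed stationary measure at 0 makes every coordinate of its
   image under [A] nonnegative; these coordinates sum to 0. *)
Lemma stationary_max0 nu : stationary nu ->
  stationary (fun x => Num.max (nu x) 0).
Proof.
move=> h; set p := fun x => Num.max (nu x) 0.
have p_ge0 x : 0 <= p x by rewrite /p le_max lexx orbT.
have p_ge x : nu x <= p x by rewrite /p le_max lexx.
have pA y : 0 <= \sum_x p x * A x y.
  have [nuy|nuy] := leP (nu y) 0.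
    apply: sumr_ge0 => x _; have [->|xy] := eqVneq x y.
      by rewrite /p max_r // mul0r.
    by rewrite mulr_ge0 ?A_ge0.
  rewrite -[leLHS](h y); apply: ler_sum => x _; have [->|xy] := eqVneq x y.
    by rewrite /p max_l // ltW.
  by rewrite ler_wpM2r ?A_ge0.
have p0 : \sum_y \sum_x p x * A x y = 0.
  rewrite exchange_big big1 //= => x _.
  by rewrite -mulr_sumr A_sum mulr0.
move=> y; apply/eqP; move/eqP: p0; rewrite psumr_eq0 // => /allP; apply.
by rewrite mem_index_enum.
Qed.

(** Positivity spreads along edges of positive rate: if the target [y] had mass 0, the balance at
    [y] would contain a positive inflow and no negative term. *)
Lemma stationary_root_gt0 nu x : (forall x, 0 <= nu x) -> stationary nu ->
  0 < nu x -> 0 < nu o.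
Proof.
move=> nu0 h nux; have /connectP[s sp ->] := A_connect x.
elim: s x nux sp => //= y s IH x nux /andP[Axy sp]; apply: IH sp.
rewrite lt_def nu0 andbT; apply/eqP => nuy.
have := h y; rewrite (bigD1 x) //= => /eqP; apply/negP; rewrite gt_eqF //.
rewrite ltr_pwDl ?mulr_gt0 // sumr_ge0 // => z _.
have [->|zy] := eqVneq z y; first by rewrite nuy mul0r.
by rewrite mulr_ge0 ?A_ge0.
Qed.

(** If [nu o <= 0], a positive value anywhere would make the stationary positive part positive at
    [o]; so [nu <= 0] throughout, and total mass 0 forces [nu = 0]. Otherwise the same applies to
    [- nu]. *)
Lemma stationary_unique nu : stationary nu -> \sum_x nu x = 0 ->
  forall x, nu x = 0.
Proof.
have le0 mu : stationary mu -> mu o <= 0 -> forall x, mu x <= 0.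
  move=> h muo x; rewrite leNgt; apply/negP => mux.
  have : 0 < Num.max (mu o) 0.
    apply: (@stationary_root_gt0 _ x _ (stationary_max0 h)).
      by move=> y; rewrite le_max lexx orbT.
    by rewrite lt_max mux.
  by rewrite lt_max ltxx orbF ltNge muo.
move=> h s0.
have all0 (mu : T -> R) : (forall x, mu x <= 0) -> \sum_x mu x = 0 ->
    forall x, mu x = 0.
  move=> mu0 s x; apply/eqP; rewrite -oppr_eq0.
  have : \sum_x - mu x == 0 by rewrite sumrN s oppr0.
  rewrite psumr_eq0 => [|y _]; last by rewrite oppr_ge0.
  by move=> /allP/(_ x); apply; rewrite mem_index_enum.
have [nuo|nuo] := leP (nu o) 0; first exact: all0 (le0 _ h nuo) s0.
move=> x; apply: oppr_inj; rewrite oppr0.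
apply: (all0 (fun x => - nu x)); last by rewrite sumrN s0 oppr0.
by apply: (le0 _ (stationaryN h)); rewrite oppr_le0 ltW.
Qed.

End Uniqueness.

(** * The rate matrix of the process: signs, row sums, connectivity and growth *)

Section Generator.
Variables (R : realType) (L : nat) (q alpha beta gamma delta : R).
Hypotheses (q_ge0 : 0 <= q) (alpha_gt0 : 0 < alpha) (beta_gt0 : 0 < beta).
Hypotheses (gamma_ge0 : 0 <= gamma) (delta_ge0 : 0 <= delta).
Implicit Types (x y : config L) (f mu : config L -> R).
Local Notation G := (asep_generator q alpha beta gamma delta).

(** The matrix entry of [G]: the jump rate off the diagonal, minus the total exit rate on it. *)
Definition asep_rate x y : R := G (fun z => (z == y)%:R) x.

Lemma asep_generatorE f x : G f x = \sum_y asep_rate x y * f y.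
Proof.
have fE z : f z = \sum_y (z == y)%:R * f y.
  rewrite (bigD1 z) //= eqxx mul1r big1 ?addr0 // => y /negbTE.
  by rewrite eq_sym => ->; rewrite mul0r.
have df (c : R) u v : c * (f u - f v) =
    \sum_y c * ((u == y)%:R - (v == y)%:R) * f y.
  rewrite [in LHS]fE [f v]fE -sumrB mulr_sumr; apply: eq_bigr => y _.
  by rewrite -mulrBl mulrA.
rewrite /asep_rate /asep_generator.
under [RHS]eq_bigr do rewrite !mulrDl.
rewrite 2!big_split; congr (_ + _ + _).
- under [RHS]eq_bigr do rewrite mulr_suml.
  rewrite [RHS]exchange_big; apply: eq_bigr => j _ /=.
  under [RHS]eq_bigr do rewrite mulr_suml.
  by rewrite [RHS]exchange_big; apply: eq_bigr => k _ /=; rewrite df.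
- under [RHS]eq_bigr do rewrite mulr_suml.
  by rewrite [RHS]exchange_big; apply: eq_bigr => j _ /=; rewrite df.
- under [RHS]eq_bigr do rewrite mulr_suml.
  by rewrite [RHS]exchange_big; apply: eq_bigr => j _ /=; rewrite df.
Qed.

Lemma asep_rate_sum x : \sum_y asep_rate x y = 0.
Proof.
transitivity (G (fun=> 1) x).
  by rewrite asep_generatorE; apply: eq_bigr => y _; rewrite mulr1.
rewrite /asep_generator.
rewrite [X in X + _ + _]big1 ?[X in _ + X + _]big1 ?big1 ?addr0 //.
- by move=> j _; rewrite subrr mulr0.
- by move=> j _; rewrite subrr mulr0.
by move=> j _; rewrite big1 // => k _; rewrite subrr mulr0.
Qed.

Lemma asep_rate_ge0 x y : x != y -> 0 <= asep_rate x y.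
Proof.
move=> /negbTE xy; rewrite /asep_rate /asep_generator xy !addr_ge0 //.
- apply: sumr_ge0 => j _; apply: sumr_ge0 => k _; rewrite subr0 mulr_ge0 //.
  by case: ifP => // _; case: ifP.
- apply: sumr_ge0 => j _; rewrite subr0 mulr_ge0 //.
  by case: ifP => // _; exact: ltW.
- apply: sumr_ge0 => j _; rewrite subr0 mulr_ge0 //.
  by case: ifP => // _; exact: ltW.
Qed.

Lemma asep_rate_bulk_gt0 x (j k : 'I_L) : k = j.+1 :> nat -> x j -> ~~ x k ->
  0 < asep_rate x (swap j k x).
Proof.
move=> kj xj xk; have ne : x == swap j k x = false.
  apply/eqP => /ffunP/(_ j); rewrite ffunE tpermL xj => e.
  by move: xk; rewrite -e.
rewrite /asep_rate /asep_generator ne -addrA ltr_pwDl //; last first.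
  rewrite addr_ge0 //; apply: sumr_ge0 => i _; rewrite subr0 mulr_ge0 //;
  by case: ifP => // _; exact: ltW.
rewrite (bigD1 j) //= ltr_pwDl //; last first.
  apply: sumr_ge0 => i _; apply: sumr_ge0 => l _; rewrite subr0 mulr_ge0 //.
  by case: ifP => // _; case: ifP.
rewrite (bigD1 k) ?kj //= ltr_pwDl //; last first.
  apply: sumr_ge0 => l _; rewrite subr0 mulr_ge0 //.
  by case: ifP => // _; case: ifP.
by rewrite xj xk eqxx subr0 mulr1.
Qed.

Lemma asep_rate_exit_gt0 x (j : 'I_L) : j.+1 = L -> x j ->
  0 < asep_rate x (flip j x).
Proof.
move=> jL xj; have ne : x == flip j x = false.
  by apply/eqP => /ffunP/(_ j); rewrite ffunE eqxx xj.
rewrite /asep_rate /asep_generator ne addrC ltr_pwDl //; last first.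
  rewrite addr_ge0 //; apply: sumr_ge0 => i _.
    apply: sumr_ge0 => l _; rewrite subr0 mulr_ge0 //.
    by case: ifP => // _; case: ifP.
  by rewrite subr0 mulr_ge0 //; case: ifP => // _; exact: ltW.
rewrite (bigD1 j) ?jL //= ltr_pwDl //; last first.
  apply: sumr_ge0 => i _; rewrite subr0 mulr_ge0 //.
  by case: ifP => // _; exact: ltW.
by rewrite xj eqxx subr0 mulr1.
Qed.

(* Move the rightmost particle to the right until it leaves: the total distance
   of the particles to the right reservoir decreases. *)
Lemma asep_connect_empty x :
  connect (fun x y => 0 < asep_rate x y) x [ffun=> false].
Proof.
pose D x := (\sum_(j < L | x j) (L - j))%N.
elim/ltn_ind : {x}(D x) {-2}x (erefl (D x)) => n IH x Dx.
have [[i xi]|nx] := pselect (exists i, x i); last first.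
  suff -> : x = [ffun=> false] by exact: connect0.
  apply/ffunP => i; rewrite ffunE; apply/negbTE/negP => xi.
  by apply: nx; exists i.
pose j := [arg max_(k > i | x k) (k : nat)].
have [xj jmax] : x j /\ forall k, x k -> (k <= j)%N.
  by rewrite /j; case: arg_maxnP.
have [jL|jL] := eqVneq j.+1 L.
  apply: connect_trans (connect1 (asep_rate_exit_gt0 jL xj)) _.
  apply: IH (erefl _); rewrite -Dx /D [X in (_ < X)%N](bigD1 j) //=.
  have -> : (\sum_(k < L | flip j x k) (L - k) =
             \sum_(k < L | x k && (k != j)) (L - k))%N.
    apply: eq_bigl => k; rewrite ffunE.
    by case: eqP => [->|]; rewrite ?xj ?andbF ?andbT.
  by rewrite -[X in (X < _)%N]add0n ltn_add2r subn_gt0.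
have kL : (j.+1 < L)%N by have := ltn_ord j; lia.
pose k := Ordinal kL; have xk : ~~ x k.
  by apply/negP => /jmax; rewrite /= ltnn.
apply: connect_trans (connect1 (@asep_rate_bulk_gt0 x j k erefl xj xk)) _.
apply: IH (erefl _); rewrite -Dx /D [X in (_ < X)%N](bigD1 j) //=.
have jk : j != k by rewrite -val_eqE /= neq_ltn leqnn.
rewrite (bigD1 k) /=; last by rewrite ffunE tpermR.
have -> : (\sum_(l < L | swap j k x l && (l != k)) (L - l) =
           \sum_(l < L | x l && (l != j)) (L - l))%N.
  apply: eq_bigl => l; rewrite ffunE.
  by case: tpermP => [->|->|/eqP -> /eqP ->];
    rewrite ?eqxx ?andbF ?andbT ?(negbTE xk) ?xj.
by rewrite ltn_add2r ltn_sub2l.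
Qed.

(** With [K] the sum of all absolute matrix entries, one application of [G] multiplies a uniform
    bound by at most [K]. *)
Lemma asep_iter_le f : exists2 K : R, 0 <= K &
  exists M : R, forall n x, `|iter n G f x| <= M * K ^+ n.
Proof.
pose K : R := \sum_x \sum_y `|asep_rate x y|.
have K0 : 0 <= K by apply: sumr_ge0 => x _; apply: sumr_ge0.
exists K => //; exists (\sum_x `|f x|); elim=> [|n IH] x.
  by rewrite expr0 mulr1 (bigD1 x) //= lerDl sumr_ge0.
rewrite iterS asep_generatorE (le_trans (ler_norm_sum _ _ _)) //.
apply: (@le_trans _ _ (\sum_y `|asep_rate x y| * ((\sum_x `|f x|) * K ^+ n))).
  by apply: ler_sum => y _; rewrite normrM ler_wpM2l // IH.
rewrite -mulr_suml exprSr [leRHS]mulrA [leRHS]mulrC ler_wpM2r //.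
  by apply: mulr_ge0; [apply: sumr_ge0|apply: exprn_ge0].
by rewrite [leRHS](bigD1 x) //= lerDl sumr_ge0 // => y _; apply: sumr_ge0.
Qed.

End Generator.

(** * Reading the first-order coefficient off a constant exponential series *)

Lemma geometric_sum_le2 (R : realFieldType) (x : R) N : 0 <= x -> x <= 2^-1 ->
  \sum_(i < N) x ^+ i <= 2.
Proof.
move=> x0 x2; elim: N => [|N IH]; first by rewrite big_ord0.
rewrite big_ord_recl expr0; under eq_bigr do rewrite exprS.
rewrite -mulr_sumr.
have : x * \sum_(i < N) x ^+ i <= 2^-1 * 2.
  by apply: ler_pM => //; apply: sumr_ge0 => i _; apply: exprn_ge0.
by rewrite mulVf //; lra.
Qed.

(** A derivative at 0 by a direct estimate: the terms of order at least 2 are [O(t ^ 2)], so the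
    linear term, which they must cancel, has coefficient 0. *)
Lemma exp_series_const_coef1 (R : realType) (c : nat -> R) (M K : R) :
  0 <= K -> (forall n, `|c n| <= M * K ^+ n) ->
  (forall t : R, 0 <= t ->
    (series (fun n => t ^+ n / n`!%:R * c n) @ \oo --> c 0%N)%classic) ->
  c 1%N = 0.
Proof.
move=> K0 cM lim_c.
have M0 : 0 <= M by have := cM 0%N; rewrite expr0 mulr1; apply: le_trans.
have bnd t : 0 <= t -> t * K <= 2^-1 -> t * `|c 1%N| <= 2 * M * (t * K) ^+ 2.
  move=> t0 tK; have := lim_c t t0; rewrite -(cvg_shiftn 2) => cv.
  have cv' : ((fun n : nat =>
      `|series (fun n => t ^+ n / n`!%:R * c n) (n + 2)%N
         - (c 0%N + t * c 1%N)|)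
      @ \oo --> `|c 0%N - (c 0%N + t * c 1%N)|)%classic.
    by apply: cvg_norm; apply: cvgB => //; exact: cvg_cst.
  have -> : t * `|c 1%N| = `|c 0%N - (c 0%N + t * c 1%N)|.
    by rewrite opprD addNKr normrN normrM ger0_norm.
  apply: (cvgr_to_le cv'); apply: nearW => n.
  rewrite /series /= addn2 big_mkord 2!big_ord_recl /= !expr0 !divr1 /bump /=.
  rewrite expr1 mul1r addrA [X in `|X|]addrC addKr.
  apply: le_trans (ler_norm_sum _ _ _) _.
  (* The factorials are bounded below by 1, and what is left is geometric with ratio at most 1/2. *)
  apply: (@le_trans _ _ (\sum_(i < n) M * (t * K) ^+ 2 * (t * K) ^+ i)).
    apply: ler_sum => i _; rewrite !add1n.
    rewrite -[leRHS]mulrA -exprD add2n exprMn mulrCA normrM.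
    apply: ler_pM => //; rewrite ger0_norm ?divr_ge0 ?exprn_ge0 //.
    rewrite ler_pdivrMr ?ltr0n ?fact_gt0 // ler_peMr ?exprn_ge0 //.
    by rewrite ler1n fact_gt0.
  rewrite -mulr_sumr -[2 * M * _]mulrA [2 * _]mulrC.
  rewrite ler_wpM2l ?mulr_ge0 ?exprn_ge0 ?mulr_ge0 //.
  by rewrite geometric_sum_le2 // mulr_ge0.
apply/eqP; rewrite -normr_eq0; apply/negPn/negP => c1.
have c1_gt0 : 0 < `|c 1%N| by rewrite lt_def c1 normr_ge0.
pose C := 2 * M * K ^+ 2.
have C0 : 0 <= C by rewrite /C !mulr_ge0 ?exprn_ge0.
(* The first bound ensures [t * K <= 1/2], the second [t * C < |c 1|]; adding 1 keeps both
   denominators positive. *)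
pose t := Num.min (2 * (K + 1))^-1 (`|c 1%N| / (2 * (C + 1))).
have t_gt0 : 0 < t.
  rewrite lt_min; apply/andP.
  by split; [rewrite invr_gt0|apply: divr_gt0 => //]; lra.
have tK : t * K <= 2^-1.
  apply: (@le_trans _ _ ((2 * (K + 1))^-1 * (K + 1))).
    by apply: ler_pM => //; [exact: ltW|rewrite ge_min lexx|lra].
  by rewrite invfM -mulrA mulVf ?mulr1 //; lra.
have := bnd t (ltW t_gt0) tK.
have -> : 2 * M * (t * K) ^+ 2 = t * (t * C) by rewrite /C; ring.
rewrite ler_pM2l //; apply/negP; rewrite -ltNge.
have : t * (2 * (C + 1)) <= `|c 1%N|.
  by rewrite -ler_pdivlMr; [rewrite ge_min lexx orbT|lra].
have := mulr_ge0 (ltW t_gt0) C0; nra.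
Qed.

(** * Invariance under the semigroup as stationarity for the rate matrix *)

Section Invariance.
Variables (R : realType) (L : nat) (q alpha beta gamma delta : R).
Implicit Types (f mu : config L -> R).
Local Notation G := (asep_generator q alpha beta gamma delta).
Local Notation rate := (asep_rate q alpha beta gamma delta).

Lemma semigroup_sum_cvg mu f t :
  (series (fun n => t ^+ n / n`!%:R * \sum_x mu x * iter n G f x) @ \oo -->
   \sum_x mu x * semigroup G t f x)%classic.
Proof.
have -> : series (fun n => t ^+ n / n`!%:R * \sum_x mu x * iter n G f x) =
  (fun N => \sum_x mu x * series (fun n => t ^+ n / n`!%:R * iter n G f x) N).
  apply/funext => N; rewrite /series /=.
  under eq_bigr do rewrite mulr_sumr.
  rewrite exchange_big; apply: eq_bigr => x _ /=.
  by rewrite mulr_sumr; apply: eq_bigr => n _; rewrite mulrCA.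
apply: cvg_big => [|x _]; first exact: add_continuous.
apply: cvgMl_tmp; exact: is_cvg_semigroup.
Qed.

Lemma sum_generator mu f :
  \sum_x mu x * G f x = \sum_y (\sum_x mu x * rate x y) * f y.
Proof.
under eq_bigr do rewrite asep_generatorE mulr_sumr.
rewrite exchange_big; apply: eq_bigr => y _ /=.
by rewrite mulr_suml; apply: eq_bigr => x _; rewrite mulrA.
Qed.

(** Forwards, the coefficient of [t] in the integral of the semigroup applied to the indicator of
    [y] is the balance at [y]. Backwards, stationarity kills every coefficient of positive order. *)
Lemma semigroup_invariantP mu :
  (forall (t : R) f, 0 <= t ->
     \sum_x mu x * semigroup G t f x = \sum_x mu x * f x) <->
  stationary rate mu.
Proof.
split=> [inv y|st t f _].
  have [K K0 [M GM]] :=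
    asep_iter_le q alpha beta gamma delta (fun z => (z == y)%:R).
  pose c n := \sum_x mu x * iter n G (fun z => (z == y)%:R) x.
  apply: (@exp_series_const_coef1 _ c ((\sum_x `|mu x|) * M) K K0) => [n|t t0].
    rewrite (le_trans (ler_norm_sum _ _ _)) // -mulrA mulr_suml.
    apply: ler_sum => x _.
    by rewrite normrM ler_wpM2l.
  have := semigroup_sum_cvg (mu := mu) (f := fun z => (z == y)%:R) (t := t).
  by rewrite inv.
have c0 n : \sum_x mu x * iter n.+1 G f x = 0.
  rewrite iterS sum_generator big1 // => y _.
  by have := st y; rewrite /stationary => ->; rewrite mul0r.
have := semigroup_sum_cvg (mu := mu) (f := f) (t := t); rewrite -cvg_shiftS.
(* From the first term on, the partial sums are constant; the shift by one skips the empty sum. *)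
have -> : [sequence series (fun n =>
    t ^+ n / n`!%:R * \sum_x mu x * iter n G f x) N.+1]_N =
    (fun=> \sum_x mu x * f x).
  apply/funext => N; rewrite /series /= big_mkord big_ord_recl.
  rewrite [X in _ + X]big1 => [|i _].
    by rewrite expr0 fact0 divr1 mul1r addr0.
  by rewrite lift0 c0 mulr0.
by move=> h; apply: (cvg_unique _ h); [exact: norm_hausdorff|exact: cvg_cst].
Qed.

End Invariance.

(** * Identification of the invariant measure with the top marginal *)

Theorem theorem1p1 (R : realType) (L : nat) (q alpha beta gamma delta : R)
    (hL : (1 <= L)%N)
    (hq0 : 0 <= q) (hq1 : q < 1)
    (halpha0 : 0 < alpha) (halpha1 : alpha <= 1)
    (hbeta0 : 0 < beta) (hbeta1 : beta <= 1)
    (hgamma : gamma = q * (1 - alpha)) (hdelta : delta = q * (1 - beta))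
    (mu : config L -> R) :
  invariant_probability (asep_generator q alpha beta gamma delta) mu <->
  forall tau : config L,
    mu tau =
      \sum_(xi : config L)
        TL_prob ((1 - alpha) / alpha) ((1 - beta) / beta) q tau xi.
Proof.
set a := (1 - alpha) / alpha; set b := (1 - beta) / beta.
have a0 : 0 <= a by rewrite divr_ge0 ?subr_ge0 // ltW.
have b0 : 0 <= b by rewrite divr_ge0 ?subr_ge0 // ltW.
have gamma0 : 0 <= gamma by rewrite hgamma mulr_ge0 ?subr_ge0.
have delta0 : 0 <= delta by rewrite hdelta mulr_ge0 ?subr_ge0.
pose Z := TL_partition L a b q.
have Z0 : 0 < Z by apply: TL_partition_gt0.
pose pi tau := \sum_(xi : config L) TL_prob a b q tau xi.
have piE tau : pi tau = (top_poly q b tau).[a] / Z.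
  by rewrite horner_top_poly mulr_suml.
have pi1 : \sum_tau pi tau = 1.
  under eq_bigr do rewrite piE horner_top_poly.
  by rewrite -mulr_suml divff ?gt_eqF.
have pi_stat : stationary (asep_rate q alpha beta gamma delta) pi.
  move=> y; under eq_bigr do rewrite piE mulrAC.
  by rewrite -mulr_suml top_poly_stationary ?mul0r.
split=> [[mu0 mu1 /semigroup_invariantP mu_stat] tau|muE].
  apply/eqP; rewrite -subr_eq0; apply/eqP.
  (* The difference of two stationary probability measures is a signed stationary measure of total
     mass 0. *)
  apply: (@stationary_unique _ _ (asep_rate q alpha beta gamma delta)
    [ffun=> false] _ _ _ (fun x => mu x - pi x)).
  - exact: asep_rate_ge0.
  - exact: asep_rate_sum.
  - exact: asep_connect_empty.
  - move=> y; under eq_bigr do rewrite mulrBl.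
    by rewrite sumrB mu_stat pi_stat subrr.
  - by rewrite sumrB mu1 pi1 subrr.
have -> : mu = pi by apply/funext.
split; [|exact: pi1|exact/semigroup_invariantP].
move=> x; apply: sumr_ge0 => xi _.
by rewrite divr_ge0 ?(ltW Z0) // TL_weight_ge0.
Qed.
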